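(* Fix a positive integer $D$. The $D$-th skew Ferrers operator $T_D=\sum_{\lambda\in\mathscr Q^{[D]}}T_\lambda$ acting on the $D$-decorated partition function produces the generating series of Euler characteristics of the $[n,n+D]$-nested punctual Hilbert schemes on a smooth surface: $$\mathsf{FZ}_D(q)=T_D.F^{[D]}(\vec y;q)\Big|_{\vec y=1}.$$
   Context: The series $\mathsf{FZ}_D$. Let $(S,p)$ be a smooth complex quasiprojective surface with a closed point, and $S_p^{[n,n+D]}$ the fine moduli space of pairs $Z_1\subset Z_2$ of finite closed subschemes of $S$ of lengths $n$, $n+D$ with $Z_2$ supported at $p$. Put $\mathsf{FZ}_D(q)=\sum_{n\ge0}\chi(S_p^{[n,n+D]})q^n\in\mathbb Z[[q]]$, with $\chi$ the topological Euler characteristic (equivalently, $\chi(S_p^{[n,n+D]})$ is the number of pairs of Ferrers diagrams $\mu\subset\mu'$ of sizes $n$, $n+D$). Diagrams. A Ferrers diagram is a finite subset $\lambda\subset\mathbb N^2$ ($\mathbb N\ni0$) closed downwards for the componentwise order; its size is its cardinality. Elements are drawn as unit boxes in English notation ($x$-axis left to right, $y$-axis top to bottom), so rows are the parts of a partition. A skew Ferrers diagram is a set-theoretic difference of two Ferrers diagrams; its connected components are taken with respect to boxes sharing an edge. Two skew Ferrers diagrams are equivalent up to translation if there is a bijection between their connected components such that corresponding components differ by a translation by a vector of $\mathbb Z^2$ (depending on the component). $\mathscr Q^{[D]}$ is the set of equivalence classes of skew Ferrers diagrams of size $D$, and $\mathscr Q=\coprod_D\mathscr Q^{[D]}$. Operators,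 connected case. Let $\lambda$ be connected. The north-west path of $\lambda$ is the path along the boundary of $\lambda$ from its north-easternmost point to its south-westernmost point whose first step goes west; it consists of $\ell_1$ steps west, then $v_1$ steps south, ..., then $\ell_M$ steps west, then $v_M$ steps south, with all $\ell_i,v_i\ge1$. Put $L=L(\lambda)=\sum_{i=1}^M\ell_i$. For formal variables $y_{j,h}$, $(j,h)\in\mathbb N\times\mathbb N$, and $j\ge0$ set $$S_{[j,j+L-1]}=\prod_{k=1}^M\left[\left(\frac{\mathrm d}{\mathrm dy_{j+\sum_{i=k+1}^M\ell_i,\,v_k}}-\delta_{k<M}\frac{\mathrm d}{\mathrm dy_{j+\sum_{i=k+1}^M\ell_i,\,v_k+1}}\right)\prod_{p=0}^{\ell_k-2}\frac{\mathrm d}{\mathrm dy_{j+\sum_{i=k}^M\ell_i-p-1,\,0}}\right],$$ where $\delta_{k<M}$ is $1$ if $k<M$ and $0$ otherwise, and empty sums are $0$, empty products $1$. Then $T_\lambda=\sum_{j\ge0}S_{[j,j+L-1]}$. Operators, general case. If $\lambda$ has connected components $\lambda^{(1)},\ldots,\lambda^{(N)}$, let $S^{(i)}_I$ be the summand of $T_{\lambda^{(i)}}$ indexed by the interval $I=[j,j+L(\lambda^{(i)})-1]\subset\mathbb N$, and $$T_\lambda=\frac1{\prod_{\rho\in\mathscr Q}\mathfrak s_\rho(\lambda)!}\sum_{(I^{(1)},\ldots,I^{(N)})}S^{(1)}_{I^{(1)}}\cdots S^{(N)}_{I^{(N)}},$$ the sum being over $N$-tuples of pairwise disjoint intervals $I^{(h)}\subset\mathbb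 N$ of $L(\lambda^{(h)})$ consecutive integers, and $\mathfrak s_\rho(\lambda)$ the number of connected components of $\lambda$ equal to $\rho$ up to translation. Partition function. The $D$-decorated partition function is $$F^{[D]}(\vec y;q)=\Big(\prod_{k=1}^Dy_{0,k}\Big)\prod_{j\ge1}\Big(y_{j,0}+y_{j,1}q^j+y_{j,1}y_{j,2}q^{2j}+\cdots+\Big(\prod_{k=1}^Dy_{j,k}\Big)\sum_{m_j\ge D}q^{jm_j}\Big).$$ Each summand of $T_\lambda$ is a finite polynomial in derivatives and acts on the finitely many factors of $F^{[D]}$ containing the relevant variables; $|_{\vec y=1}$ means setting all variables equal to $1$ after differentiation, and the resulting sum over $j$ (or over interval tuples) is taken in $\mathbb Z[[q]]$. *)

(* Defs.v *)
From HB Require Import structures.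
From mathcomp Require Import all_boot all_order all_algebra finmap.
From mathcomp Require Import boolp classical_sets functions cardinality fsbigop.
From mathcomp.multinomials Require Import monalg.

Set Implicit Arguments.
Unset Strict Implicit.
Unset Printing Implicit Defensive.

Import GRing.Theory.

Local Open Scope ring_scope.

(* A record rather than an alias of [nat -> R], so that the product cannot be
   confused with the pointwise one. *)
Record fps (R : Type) := Fps { fps_coef :> nat -> R }.

HB.instance Definition _ (R : Type) := gen_eqMixin (fps R).
HB.instance Definition _ (R : Type) := gen_choiceMixin (fps R).

Section FpsRing.
Variable R : comNzRingType.
Implicit Types a b c : fps R.

Definition fps_add a b : fps R := Fps (fun n => a n + b n).
Definition fps_opp a : fps R := Fps (fun n => - a n).
Definition fps_mul a b : fps R :=
  Fps (fun n => \sum_(i < n.+1) a i * b (n - i)%N).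
Definition fpsC (x : R) : fps R := Fps (fun n => if n == 0%N then x else 0).
Definition fpsXn (m : nat) : fps R := Fps (fun n => (n == m)%:R).

Lemma fpsP a b : (forall n, a n = b n) -> a = b.
Proof. by case: a b => [a] [b] /= /funext ->. Qed.

Fact fps_addA : associative fps_add.
Proof. by move=> a b c; apply: fpsP => n /=; rewrite addrA. Qed.
Fact fps_addC : commutative fps_add.
Proof. by move=> a b; apply: fpsP => n /=; rewrite addrC. Qed.
Fact fps_add0 : left_id (fpsC 0) fps_add.
Proof. by move=> a; apply: fpsP => n /=; rewrite if_same add0r. Qed.
Fact fps_addN : left_inverse (fpsC 0) fps_opp fps_add.
Proof. by move=> a; apply: fpsP => n /=; rewrite if_same addNr. Qed.

HB.instance Definition _ :=
  GRing.isZmodule.Build (fps R) fps_addA fps_addC fps_add0 fps_addN.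

Let trunc m a : {poly R} := \poly_(i < m.+1) a i.

Lemma fps_mul_trunc m n a b :
  (n <= m)%N -> fps_mul a b n = (trunc m a * trunc m b)`_n.
Proof.
move=> le_nm; rewrite coefM /=; apply: eq_bigr => i _; rewrite !coef_poly !ltnS.
by rewrite (leq_trans _ le_nm) ?leq_ord// (leq_trans (leq_subr _ _) le_nm).
Qed.

Lemma coef_trunc m n a : (n <= m)%N -> (trunc m a)`_n = a n.
Proof. by move=> le_nm; rewrite coef_poly ltnS le_nm. Qed.

Fact fps_mulC : commutative fps_mul.
Proof.
by move=> a b; apply: fpsP => n; rewrite !(fps_mul_trunc _ _ (leqnn n)) mulrC.
Qed.
Fact fps_mulA : associative fps_mul.
Proof.
move=> a b c; apply: fpsP => n.
transitivity ((trunc n a * trunc n b * trunc n c)`_n); last first.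
  rewrite coefM /=; apply: eq_bigr => i _.
  by rewrite -fps_mul_trunc ?leq_ord// coef_trunc// leq_subr.
rewrite -mulrA coefM /=; apply: eq_bigr => i _.
by rewrite -(@fps_mul_trunc n) ?leq_subr// coef_trunc// leq_ord.
Qed.
Fact fps_mul1 : left_id (fpsC 1) fps_mul.
Proof.
move=> a; apply: fpsP => n /=; rewrite big_ord_recl /= mul1r subn0.
by rewrite big1 ?addr0// => i _; rewrite mul0r.
Qed.
Fact fps_mulD : left_distributive fps_mul +%R.
Proof.
move=> a b c; apply: fpsP => n /=; rewrite -big_split /=.
by apply: eq_bigr => i _; rewrite mulrDl.
Qed.
Fact fps_oner_neq0 : fpsC 1 != 0.
Proof.
by apply/eqP => /(congr1 (fun a : fps R => a 0%N)) /= /eqP; rewrite oner_eq0.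
Qed.

HB.instance Definition _ := GRing.Zmodule_isComNzRing.Build (fps R)
  fps_mulA fps_mulC fps_mul1 fps_mulD fps_oner_neq0.

End FpsRing.

Section FpsConvergence.
Local Open Scope classical_set_scope.
Variable R : comNzRingType.

(* [q]-adic limits: every coefficient is eventually constant. *)
Definition fps_lim_coef (u : nat -> fps R) (n : nat) : set R :=
  [set x | exists N0, forall N, (N0 <= N)%N -> u N n = x].

Definition fps_converges (u : nat -> fps R) :=
  forall n, fps_lim_coef u n !=set0.

Definition fps_lim (u : nat -> fps R) : fps R :=
  Fps (fun n => xget 0 (fps_lim_coef u n)).

(* [q]-adic sums: every coefficient is a finite sum. *)
Definition fps_summable (I : choiceType) (A : set I) (u : I -> fps R) :=
  forall n, finite_set (A `&` [set i | u i n != 0]).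

Definition fps_sum (I : choiceType) (A : set I) (u : I -> fps R) : fps R :=
  Fps (fun n => \sum_(i \in A) u i n).

End FpsConvergence.

(* The box [(x, y)] is in column [x] and row [y]; [y] grows southwards. *)
Definition diagram := {fset nat * nat}.

Definition is_ferrers (l : diagram) : Prop :=
  forall a b : nat * nat,
    b \in l -> (a.1 <= b.1)%N -> (a.2 <= b.2)%N -> a \in l.

Definition is_skew (l : diagram) : Prop :=
  exists m m' : diagram, [/\ is_ferrers m, is_ferrers m' & l = (m' `\` m)%fset].

Definition adjacent (a b : nat * nat) : bool :=
  ((a.1 == b.1) && ((a.2.+1 == b.2) || (b.2.+1 == a.2)))
  || ((a.2 == b.2) && ((a.1.+1 == b.1) || (b.1.+1 == a.1))).

Definition component (l : diagram) (a : l) : diagram :=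
  [fset val b | b : l &
     connect (fun u v : l => adjacent (val u) (val v)) a b]%fset.

Definition components (l : diagram) : {fset diagram} :=
  [fset component a | a : l]%fset.

Definition embed (l : diagram) : {fset int * int} :=
  [fset (a.1%:Z, a.2%:Z) | a in l]%fset.

Definition translates (c d : diagram) : Prop :=
  exists v : int * int, [fset (a + v)%R | a in embed c]%fset = embed d.

Definition skew_equiv (l m : diagram) : Prop :=
  exists2 f : components l -> components m,
    bijective f & forall c, translates (val c) (val (f c)).

Lemma translates_refl c : translates c c.
Proof.
exists 0; apply/fsetP => a; apply/imfsetP/idP => [[b /= bc ->]|ac].
  by rewrite addr0.
by exists a; rewrite ?addr0.
Qed.

Lemma translates_sym c d : translates c d -> translates d c.
Proof.
case=> v cd; exists (- v); rewrite -cd; apply/fsetP => a; apply/imfsetP/idP.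
  by case=> _ /imfsetP[b /= bc ->] ->; rewrite addrK.
by move=> ac; exists (a + v); rewrite ?addrK//; apply/imfsetP; exists a.
Qed.

Lemma translates_trans c d e :
  translates c d -> translates d e -> translates c e.
Proof.
case=> v cd [w de]; exists (v + w); rewrite -de -cd; apply/fsetP => a; apply/imfsetP/imfsetP.
  case=> b /= bc ->; exists (b + v); rewrite ?addrA//.
  by apply/imfsetP; exists b.
by case=> _ /imfsetP[b /= bc ->] ->; exists b; rewrite ?addrA.
Qed.

Lemma skew_equiv_refl l : skew_equiv l l.
Proof. by exists id; [exists id | move=> c; exact: translates_refl]. Qed.

Lemma skew_equiv_sym l m : skew_equiv l m -> skew_equiv m l.
Proof.
case=> f [g fK gK] tf; exists g; first by exists f.
by move=> c; apply: translates_sym; rewrite -{2}(gK c).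
Qed.

Lemma skew_equiv_trans l m n :
  skew_equiv l m -> skew_equiv m n -> skew_equiv l n.
Proof.
case=> f bf tf [g bg tg]; exists (g \o f); first exact: bij_comp.
by move=> c; apply: translates_trans (tf c) (tg _).
Qed.

Record skew_diagram :=
  Skew { skew_val :> diagram; _ : `[< is_skew skew_val >] }.
HB.instance Definition _ := [isSub for skew_val].
HB.instance Definition _ := [Choice of skew_diagram by <:].

Definition skew_rel (l m : skew_diagram) : bool := `[< skew_equiv l m >].

Fact skew_rel_refl : reflexive skew_rel.
Proof. by move=> l; apply/asboolP/skew_equiv_refl. Qed.
Fact skew_rel_sym : symmetric skew_rel.
Proof. by move=> l m; apply/asboolP/asboolP => /skew_equiv_sym. Qed.
Fact skew_rel_trans : transitive skew_rel.
Proof.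
by move=> m l n /asboolP lm /asboolP mn; apply/asboolP/(skew_equiv_trans lm mn).
Qed.

Canonical skew_rel_equiv :=
  EquivRel skew_rel skew_rel_refl skew_rel_sym skew_rel_trans.

Definition skew_class := {eq_quot skew_rel}%qT.
HB.instance Definition _ := EqQuotient.on skew_class.
HB.instance Definition _ := Choice.on skew_class.

Definition skew_classes (D : nat) : set skew_class :=
  [set rho : skew_class | #|` skew_val (repr rho) | = D]%classic.

Definition class_mult (rho : skew_class) (l : diagram) : nat :=
  #|[pred c : components l | `[< skew_equiv (val c) (skew_val (repr rho)) >]]|.

(* All but finitely many factors of this product are [0`! = 1]. *)
Definition mult_fact (l : diagram) : nat :=
  \big[muln/1%N]_(rho \in [set: skew_class]) (class_mult rho l)`!.

(* The point [(x, y)] is the north-west corner of the box [(x, y)]. *)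
Definition is_ne_point (l : diagram) (P : int * int) : Prop :=
  exists2 b, b \in embed l & P = (b.1 + 1, b.2) /\
    forall c, c \in embed l -> (c.1 <= b.1)%R /\ (b.2 <= c.2)%R.

Definition is_sw_point (l : diagram) (P : int * int) : Prop :=
  exists2 b, b \in embed l & P = (b.1, b.2 + 1) /\
    forall c, c \in embed l -> (b.1 <= c.1)%R /\ (c.2 <= b.2)%R.

(* The unit steps west, resp. south, from [P] are on the boundary of [l] when
   exactly one of the two boxes that they separate belongs to [l]. *)
Definition west_step (l : diagram) (P : int * int) : bool :=
  ((P.1 - 1, P.2 - 1) \in embed l) != ((P.1 - 1, P.2) \in embed l).

Definition south_step (l : diagram) (P : int * int) : bool :=
  ((P.1 - 1, P.2) \in embed l) != ((P.1, P.2) \in embed l).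

(* [s = [:: (ell_1, v_1); ...; (ell_M, v_M)]] describes a path from [P] to [Q]
   along the boundary of [l], starting with a step west if [P != Q]. *)
Fixpoint boundary_path (l : diagram) (P : int * int) (s : seq (nat * nat))
    (Q : int * int) : Prop :=
  if s is (ell, v) :: s' then
    [/\ (0 < ell)%N, (0 < v)%N,
        (forall i, (i < ell)%N -> west_step l (P.1 - i%:Z, P.2)),
        (forall i, (i < v)%N -> south_step l (P.1 - ell%:Z, P.2 + i%:Z))
      & boundary_path l (P.1 - ell%:Z, P.2 + v%:Z) s' Q]
  else P = Q.

Definition is_nw_path (l : diagram) (s : seq (nat * nat)) : Prop :=
  exists P Q, [/\ is_ne_point l P, is_sw_point l Q & boundary_path l P s Q].

(* Meant for connected skew diagrams, which have exactly one such path. *)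
Definition nw_path (l : diagram) : seq (nat * nat) :=
  xget [::] [set s | is_nw_path l s]%classic.

Definition nw_length (s : seq (nat * nat)) : nat :=
  (\sum_(lv <- s) lv.1)%N.

Notation ypoly := {malg (fps rat)[{cmonom (nat * nat)%type}]}.

Definition yvar (j h : nat) : ypoly := << ucm (j, h) >>.

Definition dy (j h : nat) (g : ypoly) : ypoly :=
  \sum_(m <- msupp g) << g@_m *+ m (j, h) *g divcm m (ucm (j, h)) >>.

(* Setting all variables to [1] sends every monomial to [1]. *)
Definition eval1 (g : ypoly) : fps rat := mmap idfun (fun=> 1) g.

Definition op_comp (f g : ypoly -> ypoly) : ypoly -> ypoly := f \o g.

(* With [s] the north-west path of a connected diagram, [S_op s j] is the
   operator [S_[j, j + L - 1]]; the index [k] starts at [0] here. *)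
Definition S_op (s : seq (nat * nat)) (j : nat) : ypoly -> ypoly :=
  let M := size s in
  let ell k := (nth (0, 0)%N s k).1 in
  let v k := (nth (0, 0)%N s k).2 in
  \big[op_comp/id]_(k < M)
    op_comp
      (fun g => let x := (j + \sum_(i < M | k < i) ell i)%N in
         dy x (v k) g - (dy x (v k).+1 g) *+ (k.+1 < M)%N)
      (\big[op_comp/id]_(p < (ell k).-1)
         dy (j + \sum_(i < M | k <= i) ell i - p - 1)%N 0).

(* A tuple of intervals is given by the left ends of the intervals. *)
Definition interval_of (l : diagram) (j : {ffun components l -> nat})
    (c : components l) : pred nat :=
  [pred t | j c <= t < j c + nw_length (nw_path (val c))]%N.

Definition disjoint_tuples (l : diagram) : set {ffun components l -> nat} :=
  [set j | forall c d : components l, c != d ->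
     forall t, ~~ (interval_of j c t && interval_of j d t)]%classic.
Arguments disjoint_tuples : clear implicits.

Definition S_tuple (l : diagram) (j : {ffun components l -> nat}) :
    ypoly -> ypoly :=
  \big[op_comp/id]_(c : components l) S_op (nw_path (val c)) (j c).

(* The product of the factors of index [<= N] of [F^[D]]; a polynomial in
   derivatives acts on finitely many factors of [F^[D]], so its value on [F^[D]]
   at [y = 1] is the limit of its values on these truncations. *)
Definition F_trunc (D N : nat) : ypoly :=
  (\prod_(1 <= k < D.+1) yvar 0 k) *
  \prod_(1 <= j < N.+1)
    (yvar j 0
     + \sum_(1 <= m < D) fpsXn rat (j * m) *: \prod_(1 <= k < m.+1) yvar j k
     + fps_sum [set m | (D <= m)%N]%classic (fun m => fpsXn rat (j * m))
       *: \prod_(1 <= k < D.+1) yvar j k).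

Definition S_F (D : nat) (l : diagram) (j : {ffun components l -> nat})
    (N : nat) : fps rat :=
  eval1 (S_tuple j (F_trunc D N)).

Definition T_F_defined (D : nat) (l : diagram) : Prop :=
  (forall j, disjoint_tuples l j -> fps_converges (S_F D j)) /\
  fps_summable (disjoint_tuples l) (fun j => fps_lim (S_F D j)).

(* [(T_l . F^[D])|_(y = 1)]; a connected [l] has [mult_fact l = 1] and its tuples
   are single intervals, so this covers the connected case. *)
Definition T_F (D : nat) (l : diagram) : fps rat :=
  fpsC (mult_fact l)%:R^-1 *
  fps_sum (disjoint_tuples l) (fun j => fps_lim (S_F D j)).

Definition nested_pairs (n m : nat) : set (diagram * diagram) :=
  [set p | [/\ is_ferrers p.1, is_ferrers p.2, (p.1 `<=` p.2)%fset,
              #|` p.1 | = n & #|` p.2 | = m]]%classic.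

(* The Euler characteristic of the punctual nested Hilbert scheme
   [S_p^[n, n + D]] is the number of its torus-fixed points, the pairs of
   monomial ideals; it is represented here by this number. *)
Definition euler_char_nested (n D : nat) : nat :=
  #|` fset_set (nested_pairs n (n + D)) |.

Definition FZ (D : nat) : fps rat :=
  Fps (fun n => (euler_char_nested n D)%:R).

(* Main.v *)
From HB Require Import structures.
Require Import Defs.
From mathcomp Require Import all_boot all_order all_algebra finmap.
From mathcomp Require Import boolp classical_sets functions cardinality fsbigop.
From mathcomp Require Import zify.
From mathcomp.multinomials Require Import monalg.

(** Both sides count pairs of nested Ferrers diagrams, with the same weights.

Let [m_x] be the number of rows of length [x] of a Ferrers diagram [mu]; it is
also the length of the vertical segment of the boundary of [mu] at abscissa
[x], and for [x = 0] this segment is a half-line. The coefficient of [q^n] in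
the product of the factors of [F^[D]] runs over the sequences [m] with
[\sum_(x >= 1) x * m_x = n], that is, over the Ferrers diagrams of size [n]
([coef_prod_multiples], [count_by_mult]), and the monomial in the [y_{x,h}]
records [min m_x D]. At [y = 1], the derivative by [y_{x,0}] therefore keeps
the diagrams with [m_x = 0], the derivative by [y_{x,h}] with [h > 0] those
with [h <= m_x], and the difference of the derivatives by [y_{x,h}] and
[y_{x,h+1}] those with [m_x = h] ([eval_at1_act_factor], [eval1_run]).

So the summand [S_[j, j+L-1]] of the operator of a connected [lambda] keeps the
[mu] whose boundary over the columns [j .. j+L-1] is the north-west path of
[lambda], except that it may go further south at its west end. These are the
[mu] to which a translate of [lambda] with leftmost column [j] can be added so
that the result is again a Ferrers diagram ([place_exists], [addable_fits]),
and this translate is unique ([translated_eq]). When [lambda] has several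
components and their column intervals are disjoint, the translates can be added
together and do not touch each other; conversely, the components of a skew
diagram [mu' \ mu] occupy disjoint intervals of columns ([fits_places],
[places_fits]). Hence the sum over the tuples of intervals counts the nested
pairs [(mu, mu')] together with a matching of the components of [lambda] with
translates of them, the components of [mu' \ mu]. When [mu' \ mu] is in the
class of [lambda] there are [mult_fact lambda] such matchings ([places_list]),
and none otherwise, so [T_F D lambda] counts the nested pairs of that class
([T_F_coef_adds]). There are finitely many classes of size [D]
([finite_skew_classes]), and summing over them gives all the nested pairs
([sum_classes_adds]).

The geometry rests on two remarks. Skew diagrams are the finite order-convex
sets, and two comparable boxes of a convex set are joined by a staircase inside
it ([convex_step]). In a connected convex set two consecutive columns share a
row ([overlap]); therefore the columns form an interval, their tops descend
westwards, and the north-west path is the list of the differences of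
consecutive tops ([has_profile], [nw_path_profile]). *)

Set Implicit Arguments.
Unset Strict Implicit.
Unset Printing Implicit Defensive.
Import Order.TTheory GRing.Theory Num.Theory.

Local Open Scope nat_scope.

(** * Ferrers diagrams, column heights and multiplicities of rows *)

Definition height (mu : diagram) (x : nat) : nat := #|` [fset p in mu | p.1 == x]%fset |.

(** A column of a Ferrers diagram is an initial segment of [nat], hence is
determined by its cardinal. *)
Lemma mem_height (mu : diagram) x y : is_ferrers mu -> ((x, y) \in mu) = (y < height mu x).
Proof.
move=> muF.
have exout : exists y, (x, y) \notin mu.
  pose b := \max_(p <- mu) p.2; exists b.+1; apply/negP => bmu.
  have := @leq_bigmax_seq _ (enum_fset mu) xpredT (fun p : nat * nat => p.2) (x, b.+1) bmu isT.
  by rewrite ltnn.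
pose h := ex_minn exout.
have memh z : ((x, z) \in mu) = (z < h).
  rewrite /h; case: ex_minnP => k knot kmin; apply/idP/idP => [zmu|zk].
    rewrite ltnNge; apply/negP => kz; move/negP: knot; apply.
    exact: (muF (x, k) _ zmu).
  by apply/negPn/negP => /kmin; rewrite leqNgt zk.
rewrite memh; congr (_ < _).
have -> : height mu x = #|` [fset (x, val i) | i : 'I_h]%fset|.
  congr (size (enum_fset _)); apply/fsetP => -[x' z]; apply/idP/imfsetP => /=.
    rewrite !inE /= => /andP[zmu /eqP E]; subst x'; rewrite memh in zmu.
    by exists (Ordinal zmu).
  by case=> i _ [-> ->]; rewrite !inE /= memh ltn_ord eqxx.
by rewrite card_imfset /= ?size_enum_ord -?cardE ?card_ord// => i i' [/val_inj].
Qed.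

Lemma height_anti (mu : diagram) x x' : is_ferrers mu -> x <= x' -> height mu x' <= height mu x.
Proof.
move=> muF xx'; case E: (height mu x') => [//|h]; rewrite -mem_height//.
by apply: (muF (x, h) (x', h)) => //; rewrite mem_height// E.
Qed.

Lemma card_sum_height (mu : diagram) N : (forall p, p \in mu -> p.1 < N) ->
  #|` mu | = \sum_(x < N) height mu x.
Proof.
move=> muN; transitivity (\sum_(p <- mu) \sum_(x < N) (p.1 == x)).
  rewrite card_fset_sum1; apply: eq_big_seq => p pmu.
  rewrite (bigD1 (Ordinal (muN _ pmu)))//= eqxx big1// => x.
  by rewrite -val_eqE /= eq_sym => /negPf ->.
rewrite exchange_big /=; apply: eq_bigr => x _.
rewrite /height card_fset_sum1 big_fset /= [RHS]big_mkcond.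
by apply: eq_bigr => p _; case: (_ == _).
Qed.

Lemma ferrers_col_lt (mu : diagram) p : is_ferrers mu -> p \in mu -> p.1 < #|` mu |.
Proof.
move=> muF pmu; have -> : p.1.+1 = #|` [fset (val i, 0) | i : 'I_(p.1.+1)]%fset |.
  by rewrite card_imfset /= -?cardE ?card_ord// => i i' [/val_inj].
apply: fsubset_leq_card; apply/fsubsetP => _ /imfsetP[i _ ->].
by apply: (muF _ _ pmu) => //=; rewrite -ltnS.
Qed.

Lemma ferrers_row_lt (mu : diagram) p : is_ferrers mu -> p \in mu -> p.2 < #|` mu |.
Proof.
move=> muF pmu; have -> : p.2.+1 = #|` [fset (0, val i) | i : 'I_(p.2.+1)]%fset |.
  by rewrite card_imfset /= -?cardE ?card_ord// => i i' [/val_inj].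
apply: fsubset_leq_card; apply/fsubsetP => _ /imfsetP[i _ ->].
by apply: (muF _ _ pmu) => //=; rewrite -ltnS.
Qed.

Lemma ferrers_ext (mu nu : diagram) : is_ferrers mu -> is_ferrers nu ->
  height mu =1 height nu -> mu = nu.
Proof. by move=> muF nuF E; apply/fsetP => -[x y]; rewrite !mem_height// E. Qed.

(** The box of width [N] and height [K] only serves to make the set finite: [h]
is meant to vanish from [N] on and to be bounded by [K]. *)
Definition of_heights (N K : nat) (h : nat -> nat) : diagram :=
  [fset (val p.1, val p.2) | p in [pred p : 'I_N * 'I_K | val p.2 < h (val p.1)]]%fset.

Lemma mem_of_heights N K h x y : (forall x, h x <= K) -> (forall x, N <= x -> h x = 0) ->
  ((x, y) \in of_heights N K h) = (y < h x).
Proof.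
move=> hK hN; apply/imfsetP/idP => /= [[[i k]]|yh].
  by move=> lt [-> ->].
have xN : x < N by rewrite ltnNge; apply/negP => /hN E; rewrite E in yh.
by exists (Ordinal xN, Ordinal (leq_trans yh (hK x))); rewrite //= inE.
Qed.

Lemma of_heightsP N K h : (forall x, h x <= K) -> (forall x, N <= x -> h x = 0) ->
  (forall x, h x.+1 <= h x) ->
  is_ferrers (of_heights N K h) /\ height (of_heights N K h) =1 h.
Proof.
move=> hK hN hd.
have muF : is_ferrers (of_heights N K h).
  move=> [x y] [x' y']; rewrite !mem_of_heights//= => yh xx yy.
  apply: leq_trans (leq_ltn_trans yy yh) _.
  rewrite -(subnKC xx); elim: (x' - x) => [|d IH]; first by rewrite addn0.
  by rewrite addnS; exact: leq_trans (hd _) IH.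
split=> // x; apply/eqP; rewrite eqn_leq; apply/andP; split.
  by case E: (height _ x) => [//|k]; rewrite -(mem_of_heights _ _ hK hN) mem_height// E.
by case E: (h x) => [//|k]; rewrite -mem_height// mem_of_heights// E.
Qed.

Definition ferrers_of_size (n : nat) : {fset diagram} :=
  [fset mu in fpowerset (of_heights n n (fun x => if x < n then n else 0))
    | `[< is_ferrers mu >] && (#|` mu | == n)]%fset.

Lemma ferrers_of_sizeP n mu :
  reflect (is_ferrers mu /\ #|` mu | = n) (mu \in ferrers_of_size n).
Proof.
apply: (iffP idP) => [|[muF mun]]; first by rewrite !inE /= => /and3P[_ /asboolP muF /eqP].
rewrite !inE /= mun eqxx andbT; apply/andP; split; last exact/asboolP.
rewrite fpowersetE; apply/fsubsetP => -[x y] pmu.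
have := ferrers_col_lt muF pmu; have := ferrers_row_lt muF pmu; rewrite mun /= => yn xn.
by rewrite mem_of_heights ?xn// => [z|z]; [case: ifP | rewrite leqNgt => /negPf ->].
Qed.

(** For [x > 0] this is the number of rows of length [x]. The value at [x = 0] is
meaningless: the boundary of [mu] goes south forever there. *)
Definition mult (mu : diagram) (x : nat) : nat := height mu x.-1 - height mu x.

(** Summation by parts. *)
Lemma sum_mult_height h N : (forall x, h x.+1 <= h x) ->
  \sum_(x < N) x.+1 * (h x - h x.+1) + N * h N = \sum_(x < N) h x.
Proof.
move=> hd; elim: N => [|N IH]; first by rewrite !big_ord0.
by rewrite !big_ord_recr /= -IH -addnA -mulnDr subnK// mulSn addnAC addnA.
Qed.

Lemma ferrers_height0 n N mu x : mu \in ferrers_of_size n -> n <= N -> N <= x -> height mu x = 0.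
Proof.
move=> /ferrers_of_sizeP[muF mun] nN Nx; case E: (height mu x) => [//|h].
have pmu : (x, h) \in mu by rewrite mem_height// E.
by have := ferrers_col_lt muF pmu; rewrite mun /= ltnNge (leq_trans nN Nx).
Qed.

Lemma heightS mu x : is_ferrers mu -> height mu x.+1 <= height mu x.
Proof. by move=> muF; exact: height_anti. Qed.

Lemma ferrers_size_mult n N mu : mu \in ferrers_of_size n -> n <= N ->
  \sum_(x < N) x.+1 * mult mu x.+1 = n.
Proof.
move=> mun nN; have [muF muE] := ferrers_of_sizeP _ _ mun.
have := sum_mult_height N (fun x => heightS x muF).
rewrite (ferrers_height0 mun nN (leqnn N)) muln0 addn0 -card_sum_height ?muE//.
by move=> p /(ferrers_col_lt muF); rewrite muE => /leq_trans; apply.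
Qed.

(** The heights are recovered from the multiplicities from right to left, starting
at a column where both diagrams are empty. *)
Lemma mult_inj n N mu nu : mu \in ferrers_of_size n -> nu \in ferrers_of_size n ->
  n <= N -> (forall x, x < N -> mult mu x.+1 = mult nu x.+1) -> mu = nu.
Proof.
move=> mun nun nN E.
have [[muF _] [nuF _]] := (ferrers_of_sizeP _ _ mun, ferrers_of_sizeP _ _ nun).
apply: ferrers_ext => // x.
have H d : height mu (N - d) = height nu (N - d).
  elim: d => [|d IH]; first by rewrite subn0 !(ferrers_height0 _ nN (leqnn N)).
  have [dN|Nd] := ltnP d N; last by have -> : N - d.+1 = N - d by lia.
  have := E (N - d.+1); rewrite /mult /= (_ : (N - d.+1).+1 = N - d); last lia.
  have := heightS (N - d.+1) muF; have := heightS (N - d.+1) nuF.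
  rewrite (_ : (N - d.+1).+1 = N - d); last lia.
  by lia.
have [xN|Nx] := leqP x N; first by rewrite -(subKn xN).
by rewrite !(ferrers_height0 _ nN (ltnW Nx)).
Qed.

Lemma mult_surj n N (m : 'I_N -> nat) : \sum_(x < N) x.+1 * m x = n ->
  exists2 mu, mu \in ferrers_of_size n & forall x : 'I_N, mult mu x.+1 = m x.
Proof.
move=> mn; pose h x := \sum_(i : 'I_N | x <= i) m i.
have hS (x : 'I_N) : h x = m x + h x.+1.
  rewrite /h (bigD1 x)//=; congr (_ + _); apply: eq_bigl => i.
  by rewrite -val_eqE /= ltn_neqAle eq_sym andbC.
have hN x : N <= x -> h x = 0.
  move=> Nx; rewrite /h big_pred0// => i; apply/negbTE; rewrite -ltnNge.
  exact: leq_trans Nx.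
have hd x : h x.+1 <= h x.
  have [xN|Nx] := ltnP x N; first by rewrite (hS (Ordinal xN)) leq_addl.
  by rewrite hN// ltnW.
have hK x : h x <= \sum_i m i by rewrite /h [leqRHS](bigID (fun i : 'I_N => x <= i)) leq_addr.
have [muF muh] := of_heightsP hK hN hd.
exists (of_heights N (\sum_i m i) h); last by move=> x; rewrite /mult !muh /= hS addnK.
apply/ferrers_of_sizeP; split=> //; rewrite (@card_sum_height _ N) => [|[x y]].
  rewrite (eq_bigr (fun x : 'I_N => h x)) => [|x _]; last exact: muh.
  rewrite -(sum_mult_height N hd) (hN N (leqnn N)) muln0 addn0 -mn.
  by apply: eq_bigr => x _; rewrite hS addnK.
by rewrite mem_of_heights//= [x < N]ltnNge; apply: contraTN => /hN ->.
Qed.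

Lemma in_fset_filter (T : choiceType) (A : {fset T}) (P : pred T) x :
  (x \in [fset y in A | P y]%fset) = (x \in A) && P x.
Proof. by rewrite !inE. Qed.

(** Parts of size at most [N] suffice for the partitions of [n], since [n <= N]. *)
Lemma count_by_mult n N (P : nat -> pred nat) : n <= N ->
  #|[pred m : {ffun 'I_N -> 'I_n.+1} |
      (\sum_(x < N) x.+1 * m x == n)%N & [forall x : 'I_N, P x.+1 (m x)]]| =
  #|` [fset mu in ferrers_of_size n | [forall x : 'I_N, P x.+1 (mult mu x.+1)]]%fset |.
Proof.
move=> nN; pose f (mu : diagram) := [ffun x : 'I_N => inord (mult mu x.+1) : 'I_n.+1].
have multn mu (x : 'I_N) : mu \in ferrers_of_size n -> mult mu x.+1 < n.+1.
  move=> mun; rewrite ltnS -[leqRHS](ferrers_size_mult mun nN) (bigD1 x)//=.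
  by rewrite (leq_trans _ (leq_addr _ _))// leq_pmull.
pose A := [fset mu in ferrers_of_size n | [forall x : 'I_N, P x.+1 (mult mu x.+1)]]%fset.
have inA mu : (mu \in A) = (mu \in ferrers_of_size n) && [forall x : 'I_N, P x.+1 (mult mu x.+1)].
  exact: in_fset_filter.
have <- : #|` [fset f mu | mu in A]%fset| = #|` A|.
  rewrite card_in_imfset//= => mu nu; rewrite !inA => /andP[mun _] /andP[nun _] E.
  apply: (mult_inj mun nun nN) => x xN.
  have := congr1 (fun m : {ffun _ -> _} => val (m (Ordinal xN))) E.
  by rewrite /= !ffunE !inordK// ?(multn _ (Ordinal xN)).
rewrite -card_finset; congr (size (enum_fset _)); apply/fsetP => m.
rewrite !inE; apply/andP/imfsetP => [[/eqP mn /forallP mP]|[mu /=]].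
  have [mu mun muE] := mult_surj mn; exists mu.
    by rewrite inA mun; apply/forallP => x; rewrite muE.
  by apply/ffunP => x; rewrite ffunE muE inord_val.
rewrite inA => /andP[mun /forallP muP] ->; split.
  rewrite -[X in _ == X](ferrers_size_mult mun nN); apply/eqP/eq_bigr => x _.
  by rewrite ffunE inordK ?multn.
by apply/forallP => x; rewrite ffunE inordK ?multn.
Qed.

(** * Convex sets and their connected components *)

Definition convex (l : diagram) := forall x y x' y' x'' y'' : nat,
  (x, y) \in l -> (x'', y'') \in l -> x <= x' <= x'' -> y <= y' <= y'' -> (x', y') \in l.

Lemma skew_convex l : Defs.is_skew l -> convex l.
Proof.
case=> m [m' [mF m'F ->]] x y x' y' x'' y''; rewrite !inE.
move=> /andP[nm _] /andP[_ inm'] /andP[xx' x'x''] /andP[yy' y'y'']; apply/andP; split.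
  by apply: contra nm => /mF; apply.
exact: (m'F _ _ inm').
Qed.

(** A convex set is the difference of its downward closure and of what it leaves
of that closure, which is again downward closed. *)
Lemma convex_skew l : convex l -> Defs.is_skew l.
Proof.
move=> lC.
pose K := (\max_(p <- l) maxn p.1 p.2).+1.
have lK p : p \in l -> maxn p.1 p.2 < K.
  by move=> pl; rewrite ltnS (@leq_bigmax_seq _ (enum_fset l) xpredT (fun p => maxn p.1 p.2)).
pose m' : diagram := [fset (val p.1, val p.2) | p in [pred p : 'I_K * 'I_K |
   has (fun c => (val p.1 <= c.1) && (val p.2 <= c.2)) l]]%fset.
have m'P p : (p \in m') = has (fun c => (p.1 <= c.1) && (p.2 <= c.2)) l.
  apply/imfsetP/idP => [[q qm ->] //|pm].
  have /hasP[c cl /andP[p1 p2]] := pm; have := lK _ cl; rewrite gtn_max => /andP[c1 c2].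
  exists (Ordinal (leq_ltn_trans p1 c1), Ordinal (leq_ltn_trans p2 c2)) => //=.
  by case: (p) pm.
exists (m' `\` l)%fset, m'; split.
- move=> [x y] [x' y']; rewrite !inE !m'P /=.
  move=> /andP[nl /hasP[[x'' y''] cl /andP[/= px py]]] xx yy.
  apply/andP; split; last first.
    by apply/hasP; exists (x'', y'') => //=; rewrite (leq_trans xx) ?(leq_trans yy).
  apply: contra nl => al; apply: (lC x y _ _ x'' y'') => //; first by rewrite xx px.
  by rewrite yy py.
- move=> a b; rewrite !m'P => /hasP[c cl /andP[b1 b2]] ab1 ab2.
  by apply/hasP; exists c => //; rewrite (leq_trans ab1) ?(leq_trans ab2).
- apply/fsetP => p; rewrite !inE m'P negb_and negbK andb_orl andNb orbF.
  case pl : (p \in l) => //=; symmetry; apply/hasP; exists p => //.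
  by rewrite !leqnn.
Qed.

Definition closed_in (l : diagram) (P : pred (nat * nat)) :=
  forall a b, a \in l -> b \in l -> adjacent a b -> P a -> P b.

(** Connectedness by separation: a property that propagates through shared edges
holds everywhere as soon as it holds somewhere. Unlike [connect], this does not
mention the type of the boxes of [l], so it can be used for a subset of boxes
regardless of the diagram in which the subset lies. *)
Definition connected (l : diagram) := (exists a, a \in l) /\
  forall P, closed_in l P -> forall a b, a \in l -> b \in l -> P a -> P b.

Lemma adjacentC a b : adjacent a b = adjacent b a.
Proof.
by rewrite /adjacent [a.1 == _]eq_sym [a.2 == _]eq_sym; congr (_ && _ || _ && _); rewrite orbC.
Qed.

Section Components.
Variable l : diagram.
Let e := fun u v : l => adjacent (val u) (val v).

Let eC : connect_sym e.
Proof. by apply: sym_connect_sym => u v; exact: adjacentC. Qed.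

Lemma mem_component (a b : l) : (val b \in component a) = connect e a b.
Proof.
apply/imfsetP/idP => /= [[b' ab' /val_inj ->] //|ab]; by exists b.
Qed.

Lemma component_sub (a : l) b : b \in component a -> b \in l.
Proof. by case/imfsetP => b' _ ->; exact: valP. Qed.

Lemma component_closed (a : l) : closed_in l (mem (component a)).
Proof.
move=> b b' bl b'l bb' /=.
rewrite -[b]/(val [` bl]%fset) -[b']/(val [` b'l]%fset) !mem_component => ab.
by apply: connect_trans ab (connect1 _).
Qed.

Lemma component_connected (a : l) : connected (component a).
Proof.
split; first by exists (val a); rewrite mem_component.
move=> P Pcl b b' bc b'c Pb.
have bl := component_sub bc; have b'l := component_sub b'c.
have : connect e [` bl]%fset [` b'l]%fset.
  by apply: (@connect_trans _ _ a); [rewrite eC -mem_component | rewrite -mem_component].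
pose Q := [pred u : l | (val u \in component a) && P (val u)].
have QC : closed e Q.
  apply: intro_closed => // u v uv /andP[uc Pu].
  have vc := component_closed (valP u) (valP v) uv uc.
  by apply/andP; split=> //; apply: (Pcl (val u)).
have bQ : [` bl]%fset \in Q by apply/andP.
by move=> /(closed_connect QC); rewrite bQ => /esym/andP[].
Qed.

Lemma component_eq (c : diagram) (a : l) : {subset c <= l} -> connected c ->
  closed_in l (mem c) -> val a \in c -> component a = c.
Proof.
move=> cl [_ cC] cclos ac; apply/fsetP => b; apply/idP/idP => [bc|bc].
  have [_ /(_ (mem c))] := component_connected a; apply; last exact: ac; last exact: bc.
    by move=> u v /component_sub ul /component_sub vl; exact: cclos.
  by rewrite mem_component.
apply: (cC (mem (component a)) _ (val a) b) => //; last by rewrite /= mem_component.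
by move=> u v uc vc; apply: component_closed; exact: cl.
Qed.

Lemma componentsP (c : diagram) : c \in components l <->
  [/\ {subset c <= l}, connected c & closed_in l (mem c)].
Proof.
split=> [/imfsetP[a _ ->]|[cl cC cclos]].
  split; [exact: component_sub | exact: component_connected | exact: component_closed].
have [[a ac] _] := cC; apply/imfsetP; exists [` cl _ ac]%fset => //.
by apply/esym/component_eq.
Qed.
End Components.

Lemma components_cover l p : p \in l -> exists2 c, c \in components l & p \in c.
Proof.
move=> pl; exists (component [` pl]%fset); last by rewrite -[p]/(val [` pl]%fset) mem_component.
by apply/imfsetP; exists [` pl]%fset.
Qed.

Lemma components_disj l c d p : c \in components l -> d \in components l ->
  p \in c -> p \in d -> c = d.
Proof.
move=> /componentsP[cl cC cclos] /componentsP[dl dC dclos] pc pd.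
have <- : component [` cl _ pc]%fset = c by exact: component_eq.
exact: component_eq.
Qed.

Lemma components_connected l : connected l -> components l = [fset l]%fset.
Proof.
move=> lC; have ll : l \in components l by apply/componentsP; split.
apply/fsetP => c; rewrite inE; apply/idP/eqP => [cl|-> //].
have /componentsP[csub [[a ac] _] _] := cl.
exact: (components_disj cl ll ac (csub _ ac)).
Qed.

(** Two comparable boxes of a convex set are joined by a staircase inside it. *)
Lemma convex_step l P (x y x' y' : nat) : convex l -> closed_in l P -> (x, y) \in l ->
  (x', y') \in l -> x <= x' -> y <= y' -> P (x, y) = P (x', y').
Proof.
move=> lC Pcl; have Psym a b : a \in l -> b \in l -> adjacent a b -> P a = P b.
  move=> al bl ab; apply/idP/idP; first exact: Pcl.
  by apply: Pcl => //; rewrite adjacentC.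
move=> al bl xx yy; have [n E] : exists n, n = (x' - x) + (y' - y) by eexists.
elim: n x y al xx yy E => [|n IH] x y al xx yy E.
  by have [-> ->] : x = x' /\ y = y' by lia.
have [lt|ge] := ltnP x x'.
  have al' : (x.+1, y) \in l by apply: (lC x y _ _ x' y') => //; lia.
  have adj : adjacent (x, y) (x.+1, y) by rewrite /adjacent /= !eqxx orbT.
  by rewrite (Psym _ _ al al' adj); apply: IH => //; lia.
have al' : (x, y.+1) \in l by apply: (lC x y _ _ x' y') => //; lia.
have adj : adjacent (x, y) (x, y.+1) by rewrite /adjacent /= !eqxx.
by rewrite (Psym _ _ al al' adj); apply: IH => //; lia.
Qed.

Lemma components_convex l c : convex l -> c \in components l -> convex c.
Proof.
move=> lC /componentsP[cl cC cclos] x y x' y' x'' y'' ac bc /andP[xx xx'] /andP[yy yy'].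
have bl : (x', y') \in l by apply: (lC x y _ _ x'' y''); rewrite ?cl ?xx ?yy.
by rewrite -[_ \in c]/(mem c (x', y')) -(convex_step lC cclos (cl _ ac) bl).
Qed.

(** Otherwise the vertical line between the columns [k] and [k + 1] would cut [c]
into two parts without adjacent boxes. *)
Lemma overlap c (x y x' y' k : nat) : convex c -> connected c -> (x, y) \in c -> (x', y') \in c ->
  x <= k < x' -> exists2 r, (k, r) \in c & (k.+1, r) \in c.
Proof.
move=> cV [_ cC] ac bc /andP[xk kx'].
have [//|no] := pselect (exists2 r, (k, r) \in c & (k.+1, r) \in c).
suff cl : closed_in c (fun p => p.1 <= k).
  have /= := cC _ cl _ _ ac bc xk. lia.
move=> [x1 y1] [x2 y2] /= a1 a2; rewrite /adjacent /= => adj x1k.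
rewrite leqNgt; apply/negP => kx2; apply: no; exists y1.
  by have -> : k = x1 by lia.
by have [-> ->] : k.+1 = x2 /\ y1 = y2 by lia.
Qed.

(** * The north-west path of a connected skew diagram *)

Lemma mem_embed_nat (c : diagram) (x y : nat) : ((x%:Z, y%:Z)%R \in embed c) = ((x, y) \in c).
Proof.
apply/imfsetP/idP => /= [[[x' y'] /= xy [-> ->]]//|xy]; by exists (x, y).
Qed.

Lemma mem_embed (c : diagram) p : p \in embed c -> exists x y : nat, p = (x%:Z, y%:Z)%R.
Proof. by case/imfsetP => -[x y] _ ->; exists x, y. Qed.

Lemma mem_embedE (c : diagram) (p q : int) :
  ((p, q) \in embed c) = [&& (0 <= p)%R, (0 <= q)%R & (`|p|%N, `|q|%N) \in c].
Proof.
apply/idP/and3P => [pc|[]].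
  have [x [y [E1 E2]]] := mem_embed pc.
  by subst p q; split; rewrite ?le0z_nat //= -mem_embed_nat.
by case: p q => [p|p] [q|q]//= _ _; rewrite -mem_embed_nat.
Qed.

Lemma west_stepE (c : diagram) (P : int * int) (x y : nat) : P = (x.+1%:Z, y%:Z)%R ->
  west_step c P = (((0 < y) && ((x, y.-1) \in c)) != ((x, y) \in c)).
Proof.
move=> ->; rewrite /west_step /= !mem_embedE; congr (_ != _); last first.
  by rewrite (_ : x.+1%:Z - 1 = x%:Z)%R ?absz_nat//; lia.
rewrite (_ : x.+1%:Z - 1 = x%:Z)%R ?absz_nat; last lia.
by case: y => [|y] //=; rewrite subn1.
Qed.

Lemma west_step_gt0 (c : diagram) (P : int * int) : west_step c P -> (0 < P.1)%R.
Proof.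
rewrite /west_step !mem_embedE ltNge; apply: contra => le0.
have -> : (0 <= P.1 - 1)%R = false by apply/negbTE; rewrite -ltNge; lia.
by [].
Qed.

Lemma south_stepE (c : diagram) (P : int * int) (x y : nat) : P = (x%:Z, y%:Z)%R ->
  south_step c P = (((0 < x) && ((x.-1, y) \in c)) != ((x, y) \in c)).
Proof.
move=> ->; rewrite /south_step /= !mem_embedE !absz_nat /=; congr (_ != _).
by case: x => [|x] //=; rewrite subn1.
Qed.

(** The lengths of the south runs by increasing abscissa: one entry for each of
the vertical lines that bound a column of the path on its west, equal to [0]
where the path goes straight west. *)
Fixpoint profile (s : seq (nat * nat)) : seq nat :=
  if s is (l, v) :: s' then profile s' ++ v :: nseq l.-1 0 else [::].

Definition is_top (c : diagram) (x y : nat) :=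
  (x, y) \in c /\ forall y' : nat, (x, y') \in c -> y <= y'.

(** The shape of a connected skew diagram as seen from its north-west path: [a] is
the leftmost column and [T i] the top row of the column [a + i]. The first south
run from the west, [nth 0 w 0], goes along the whole leftmost column, down to
the lowest row; the others are the differences of consecutive tops. *)
Record has_profile (c : diagram) (a : nat) (w : seq nat) (T : nat -> nat) : Prop := HasProfile {
  profile_size : 0 < size w;
  profile_col : forall x y : nat, (x, y) \in c -> a <= x < a + size w;
  profile_top : forall i, i < size w -> is_top c (a + i) (T i);
  profile_drop : forall i, i.+1 < size w -> T i = T i.+1 + nth 0 w i.+1;
  profile_overlap : forall i, i.+1 < size w -> (a + i.+1, T i) \in c;
  profile_left : 0 < nth 0 w 0;
  profile_bot : (a, T 0 + (nth 0 w 0).-1) \in c;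
  profile_row : forall x y : nat, (x, y) \in c -> y < T 0 + nth 0 w 0 }.

Section Profile.
Variables (c : diagram) (a B : nat).
Hypotheses (cV : convex c) (cC : connected c).
Hypotheses (B_gt0 : 0 < B) (swc : (a, B.-1) \in c).
Hypothesis sw_min : forall x y : nat, (x, y) \in c -> a <= x /\ y < B.

(** The row shared by the two columns lies below the top of the left one. *)
Lemma top_overlap (x y y' : nat) : is_top c x y -> (x.+1, y') \in c -> (x.+1, y) \in c.
Proof.
move=> [xy top] xy'.
have [r rx rx'] : exists2 r, (x, r) \in c & (x.+1, r) \in c.
  by apply: (overlap cV cC xy xy'); rewrite leqnn ltnSn.
by apply: (cV xy rx'); rewrite ?leqnn ?leqnSn//= top.
Qed.

(** Exactly one of the two boxes along a west step is in [c]. It cannot be the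
upper one, because convexity with the box south-east of the step would put the
lower one in [c] as well. *)
Lemma west_run (x y l : nat) : is_top c x y ->
  (forall i, i < l -> west_step c (x.+1%:Z - i%:Z, y%:Z)%R) ->
  forall i, i < l -> i <= x /\ is_top c (x - i) y.
Proof.
move=> xtop west; elim=> [|i IH] il; first by rewrite subn0.
have [ix [xiy top]] := IH (ltnW il).
have ix' : i < x by have := west_step_gt0 (west _ il); rewrite /= subr_gt0 ltz_nat ltnS.
split=> //; have E : (x.+1%:Z - i.+1%:Z, y%:Z)%R = ((x - i.+1).+1%:Z, y%:Z)%R by congr pair; lia.
have := west _ il; rewrite (west_stepE _ E); set X := (_ && _) => st.
have Xf : X = false.
  apply/negbTE/negP => X1; move: (X1) st => /andP[y_gt0 up] /eqP; rewrite X1; apply.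
  by apply/esym/(cV up xiy); lia.
rewrite Xf in st; split=> [|y' xy']; first by case: (_ \in c) st.
rewrite leqNgt; apply/negP => y'y; move/negP: Xf; apply; apply/andP; split; first by lia.
have {}st : (x - i.+1, y) \in c by case: (_ \in c) st.
by apply: (cV xy' st); lia.
Qed.

(** Exactly one of the two boxes along a south step is in [c]. If it were the one
on the west, convexity would keep the two columns from sharing a row, against
[overlap]. *)
Lemma south_run (x y v : nat) : (x, y) \in c ->
  (forall i, i < v -> south_step c (x%:Z, y%:Z + i%:Z)%R) ->
  forall i, i < v -> (x, y + i) \in c /\ (0 < x -> (x.-1, y + i) \notin c).
Proof.
move=> xy south; have st i : i < v -> ((0 < x) && ((x.-1, y + i) \in c)) != ((x, y + i) \in c).
  by move=> iv; rewrite -(@south_stepE c (x%:Z, y%:Z + i%:Z)%R) ?south// PoszD.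
elim=> [|i IH] iv.
  have := st 0 iv; rewrite addn0 xy; split=> // x_gt0.
  by move: H; rewrite x_gt0 /=; case: (_ \in c).
have [xyi nxyi] := IH (ltnW iv).
have := st _ iv; case xyi' : ((x, y + i.+1) \in c).
  by move=> H; split=> // x_gt0; move: H; rewrite x_gt0 /=; case: (_ \in c).
rewrite eqbF_neg negbK => /andP[x_gt0 left].
have [r rx rx'] : exists2 r, (x.-1, r) \in c & (x.-1.+1, r) \in c.
  by apply: (overlap cV cC left xyi); lia.
rewrite prednK// in rx'; have [ry|yr] := leqP (y + i.+1) r.
  by move/negP: xyi'; case; apply: (cV xy rx'); lia.
by move/negP: (nxyi x_gt0); case; apply: (cV rx left); lia.
Qed.

Definition wf_path (s : seq (nat * nat)) := all (fun lv => (0 < lv.1) && (0 < lv.2)) s.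

(** The definition of a boundary path does not say on which side [c] lies; but
after a first step along the top of a column it has [c] below and on the east
forever, by [west_run] and [south_run], so it follows the north-west side. *)
Lemma boundary_profile s (x y : nat) : is_top c x y -> s != [::] ->
  boundary_path c (x.+1%:Z, y%:Z)%R s (a%:Z, B%:Z)%R ->
  [/\ wf_path s, x.+1 = a + size (profile s) & let w := profile s in
  exists T : nat -> nat, [/\ forall i, i < size w -> is_top c (a + i) (T i),
    forall i, i.+1 < size w -> T i = T i.+1 + nth 0 w i.+1,
    forall i, i.+1 < size w -> (a + i.+1, T i) \in c,
    T 0 + nth 0 w 0 = B /\ 0 < nth 0 w 0 & T (size w).-1 = y]].
Proof.
elim: s x y => [//|[l v] s IH] x y xtop _ /= [l_gt0 v_gt0 west south].
(* [x1] is the column below the last west step, that is, the west end of the run. *)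
have wr := west_run xtop west; have [lx [x1y top1]] : l.-1 <= x /\ is_top c (x - l.-1) y.
  by apply: wr; rewrite prednK.
pose x1 := x - l.-1; rewrite -/x1 in x1y top1.
have top_run k : x1 <= k <= x -> is_top c k y.
  move=> /andP[x1k kx]; have kl : x - k < l by rewrite /x1 in x1k; lia.
  by have [_] := wr _ kl; rewrite subKn.
have x1E : x.+1 = x1 + l by rewrite /x1; lia.
have E1 : (x.+1%:Z - l%:Z = x1%:Z)%R by rewrite /x1; lia.
rewrite E1 in south *; have sr := south_run x1y south.
have E2 : (y%:Z + v%:Z = (y + v)%:Z)%R by rewrite PoszD.
rewrite E2; have [yv nyv] : (x1, y + v.-1) \in c /\ (0 < x1 -> (x1.-1, y + v.-1) \notin c).
  by apply: sr; rewrite prednK.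
case: s IH => [|[l' v'] s] IH.
  move=> /= -[E3 E4]; split; [by rewrite /wf_path /= l_gt0 v_gt0|by rewrite /= size_nseq; lia|].
  rewrite /= size_nseq; exists (fun=> y); split => //.
  - by move=> i il; apply: top_run; lia.
  - by move=> i _; rewrite /= nth_nseq if_same addn0.
  - by move=> i il; have [] : is_top c (a + i.+1) y by apply: top_run; lia.
rewrite -/(profile _) => bp; have [_ _ west' _ _] := bp.
have l'_gt0 : 0 < l' by case: bp.
have x1_gt0 : 0 < x1.
  have := west_step_gt0 (west' 0 l'_gt0); by rewrite /= subr0 ltz_nat.
(* The west step that follows the south run starts at the top of the next column. *)
have top2 : is_top c x1.-1 (y + v).
  have := west' 0 l'_gt0; rewrite /= subr0.
  rewrite (@west_stepE c _ x1.-1 (y + v)); last by rewrite prednK.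
  rewrite (_ : (y + v).-1 = y + v.-1); last lia.
  rewrite (negPf (nyv x1_gt0)) andbF => st.
  have {}st : (x1.-1, y + v) \in c by case: (_ \in c) st.
  split=> // y' xy'; rewrite leqNgt; apply/negP => lt; move/negP: (nyv x1_gt0); apply.
  by apply: (cV xy' st); lia.
have bp' : boundary_path c (x1.-1.+1%:Z, (y + v)%:Z)%R ((l', v') :: s) (a%:Z, B%:Z)%R.
  by rewrite prednK.
have [wf' sz' [T [Ttop Tdrop Tov [T0 w0] Tlast]]] := IH _ _ top2 isT bp'.
set w' := profile ((l', v') :: s) in sz' Ttop Tdrop Tov T0 w0 Tlast *.
have w'_gt0 : 0 < size w' by have [+ _] := sw_min top2.1; lia.
have sz : size (w' ++ v :: nseq l.-1 0) = size w' + l by rewrite size_cat /= size_nseq prednK.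
have top_ge i : size w' <= i < size w' + l -> is_top c (a + i) y.
  by move=> iw; apply: top_run; lia.
split.
- by move: wf'; rewrite /wf_path /= l_gt0 v_gt0.
- by rewrite sz; lia.
rewrite sz.
exists (fun i => if i < size w' then T i else y); split.
- by move=> i iw; case: ifP => iw'; [exact: Ttop | apply: top_ge; lia].
- move=> i iw; rewrite nth_cat; case: (ltnP i.+1 (size w')) => iw'.
    by rewrite (ltnW iw') Tdrop.
  case: (ltnP i (size w')) => iw''; last first.
    have -> : i.+1 - size w' = (i - size w').+1 by lia.
    by rewrite /= nth_nseq if_same addn0.
  have -> : i.+1 - size w' = 0 by lia.
  by rewrite (_ : i = (size w').-1) ?Tlast//; lia.
- move=> i iw; case: (ltnP i.+1 (size w')) => iw'; first by rewrite (ltnW iw'); exact: Tov.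
  case: (ltnP i (size w')) => iw''; last by have [] : is_top c (a + i.+1) y by apply: top_ge; lia.
  have -> : T i = y + v by rewrite -Tlast; congr T; lia.
  have -> : a + i.+1 = x1.-1.+1 by lia.
  by apply: (top_overlap top2 (y' := y)); rewrite prednK.
- by rewrite w'_gt0 nth_cat w'_gt0.
- by rewrite ifF//; lia.
Qed.

(** The path is built from west to east: a column with the same top as its west
neighbour lengthens the first west run, another one starts a new run. *)
Lemma boundary_path_exists (x y : nat) : is_top c x y -> exists l v s,
  boundary_path c (x.+1%:Z, y%:Z)%R ((l, v) :: s) (a%:Z, B%:Z)%R.
Proof.
move: {2}(x - a) (erefl (x - a)) => n.
elim: n x y => [|n IH] x y nE [xy top].
  have [ax yB] := sw_min xy; have xa : x = a by lia.
  subst x; exists 1, (B - y), [::]; split=> //=; [by rewrite subn_gt0| | |].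
  - move=> i; rewrite ltnS leqn0 => /eqP ->; rewrite (@west_stepE c _ a y); last by rewrite subr0.
    rewrite xy; case: y {yB} top xy => //= y top _; have [/top|//] := boolP ((a, y) \in c).
    by rewrite ltnn.
  - move=> i iy; rewrite (@south_stepE c _ a (y + i)); last by rewrite -predn_int ?PoszD//.
    have -> : (a, y + i) \in c by apply: (cV xy swc); lia.
    have [left|] := boolP ((a.-1, y + i) \in c); last by rewrite andbF.
    by have [al _] := sw_min left; case: (a) al => //= a'; rewrite ltnn.
  - by congr pair; lia.
have [ax yB] := sw_min xy.
have x_gt0 : 0 < x by lia.
have [r rx rx'] : exists2 r, (x.-1, r) \in c & (x.-1.+1, r) \in c.
  by apply: (overlap cV cC swc xy); lia.
rewrite prednK// in rx'.
have exy : exists y', (x.-1, y') \in c by exists r.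
have top1 : is_top c x.-1 (ex_minn exy).
  by case: ex_minnP => y1 y1P y1min; split.
have yy1 : y <= ex_minn exy.
  case: top1 => [xy1 t1]; rewrite leqNgt; apply/negP => lt.
  have /top : (x, ex_minn exy) \in c by apply: (cV xy1 rx'); have := t1 _ rx; lia.
  by lia.
move: (ex_minn exy) top1 yy1 => y1 top1 yy1.
have [|l [v [s bp]]] := IH _ _ _ top1; first by lia.
rewrite prednK// in bp.
have west0 : west_step c (x.+1%:Z, y%:Z)%R.
  rewrite (@west_stepE c _ x y)// xy; case: y {yB yy1} top xy => //= y top _.
  by have [/top|//] := boolP ((x, y) \in c); rewrite ltnn.
have [E|lt] := eqVneq y y1.
  subst y1; exists l.+1, v, s; case: bp => [l0 v0 west south bp].
  have Es : (x.+1%:Z - l.+1%:Z = x%:Z - l%:Z)%R by lia.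
  split=> //; rewrite ?Es// => -[_|i il]; first by rewrite subr0.
  by have := west i il; rewrite /= (_ : x.+1%:Z - i.+1%:Z = x%:Z - i%:Z)%R//; lia.
exists 1, (y1 - y), ((l, v) :: s); split=> //; first by lia.
- by move=> i; rewrite ltnS leqn0 => /eqP ->; rewrite subr0.
- move=> i iy; rewrite (@south_stepE c _ x (y + i)); last by congr pair; rewrite /= ?PoszD; lia.
  have -> : (x, y + i) \in c by apply: (cV xy rx'); have := top1.2 _ rx; lia.
  have [/top1.2|] := boolP ((x.-1, y + i) \in c); last by rewrite andbF.
  by lia.
- have E : (x.+1%:Z - 1%:Z, y%:Z + (y1 - y)%:Z)%R = (x%:Z, y1%:Z)%R by congr pair; lia.
  by rewrite [fst _]/= [snd _]/= E.
Qed.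

End Profile.

Lemma convex_mem l (x y x' y' x'' y'' : nat) : convex l -> (x, y) \in l -> (x'', y'') \in l ->
  x <= x' <= x'' -> y <= y' <= y'' -> (x', y') \in l.
Proof. by move=> lC; exact: lC. Qed.

(** Going east, the tops weakly rise, by [overlap] and convexity. *)
Lemma east_reaches_up c (x y x' y' : nat) : convex c -> connected c ->
  (x, y) \in c -> (x', y') \in c ->
  x <= x' -> exists2 r, r <= y & (x', r) \in c.
Proof.
move=> cV cC xy xy' xx'; rewrite -(subnKC xx') in xy' *.
elim: (x' - x) y' xy' => [|d IH] y' xy'; first by rewrite addn0 in xy' *; exists y.
have [r rx rx'] : exists2 r, (x + d, r) \in c & ((x + d).+1, r) \in c.
  by apply: (overlap cV cC xy xy'); lia.
have [r' r'y r'x] := IH _ rx; rewrite addnS; have [ry|yr] := leqP r y; first by exists r.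
by exists r' => //; apply: (convex_mem cV r'x rx'); lia.
Qed.

(** Going west, the bottoms weakly sink, by [overlap] and convexity. *)
Lemma west_reaches_down c (x y x' y' : nat) : convex c -> connected c ->
  (x, y) \in c -> (x', y') \in c ->
  x <= x' -> exists2 r, y' <= r & (x, r) \in c.
Proof.
move=> cV cC xy xy' xx'; rewrite -(subKn xx') in xy *.
move: (leq_subr x x'); elim: (x' - x) y xy => [|d IH] y xy dx; first by rewrite subn0; exists y'.
have [r rx rx'] : exists2 r, (x' - d.+1, r) \in c & ((x' - d.+1).+1, r) \in c.
  by apply: (overlap cV cC xy xy'); lia.
have E : (x' - d.+1).+1 = x' - d by lia.
rewrite E in rx'; have [r' r'y r'x] := IH _ rx' (ltnW dx).
have [rr|rr] := leqP r r'; last by exists r => //; lia.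
by exists r' => //; apply: (convex_mem cV rx r'x); lia.
Qed.

(** The highest row meets the last column and the lowest row the first one, so
the two corner points that the path has to join exist. *)
Lemma nw_path_exists c : convex c -> connected c -> exists s, is_nw_path c s.
Proof.
move=> cV cC; have [[[x0 y0] c0] _] := cC.
have exa : exists x, has (fun p => p.1 == x) c by exists x0; apply/hasP; exists (x0, y0).
have ext : exists y, has (fun p => p.2 == y) c by exists y0; apply/hasP; exists (x0, y0).
pose K := \max_(p <- c) maxn p.1 p.2.
have cK p : p \in c -> p.1 <= K /\ p.2 <= K.
  move=> pc; have := @leq_bigmax_seq _ (enum_fset c) xpredT (fun p => maxn p.1 p.2) p pc isT.
  by rewrite geq_max => /andP[].
have ubx x : has (fun p => p.1 == x) c -> x <= K by case/hasP => p /cK[+ _] /eqP <-.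
have uby y : has (fun p => p.2 == y) c -> y <= K by case/hasP => p /cK[_ +] /eqP <-.
case: (ex_minnP exa) => a /hasP[[a' ya] ac /= /eqP]; move=> <- {a} amin.
case: (ex_minnP ext) => t /hasP[[xt t'] tc /= /eqP]; move=> <- {t} tmin.
case: (ex_maxnP exa ubx) => e /hasP[[e' ye] ec /= /eqP]; move=> <- {e} emax.
case: (ex_maxnP ext uby) => b /hasP[[xb b'] bc /= /eqP]; move=> <- {b} bmax.
have inP p : p \in c -> [/\ a' <= p.1, p.1 <= e', t' <= p.2 & p.2 <= b'].
  by move=> pc; split; [apply: amin|apply: emax|apply: tmin|apply: bmax];
     apply/hasP; exists p.
have netop : (e', t') \in c.
  have [_ xe _ _] := inP _ tc; have [r rt re] := east_reaches_up cV cC tc ec xe.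
  by have [_ _ tr _] := inP _ re; have -> : t' = r by move=> /= in tr *; lia.
have sw : (a', b') \in c.
  have [xa _ _ _] := inP _ bc; have [r rt re] := west_reaches_down cV cC ac bc xa.
  by have [_ _ _ tr] := inP _ re; have -> : b' = r by move=> /= in tr *; lia.
have sw_min (x y : nat) : (x, y) \in c -> a' <= x /\ y < b'.+1 by case/inP.
have netop' : is_top c e' t' by split=> // y' /inP[].
have [l [v [s bp]]] := boundary_path_exists cV cC (ltn0Sn b') sw sw_min netop'.
exists ((l, v) :: s), (e'.+1%:Z, t'%:Z)%R, (a'%:Z, b'.+1%:Z)%R; split=> //.
  exists (e'%:Z, t'%:Z)%R; first by rewrite mem_embed_nat.
  split; first by congr pair; rewrite /=; lia.
  by move=> p /[dup] /mem_embed[x [y ->]]; rewrite mem_embed_nat => /inP[_ ? ? _]; split.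
exists (a'%:Z, b'%:Z)%R; first by rewrite mem_embed_nat.
split; first by congr pair; rewrite /=; lia.
by move=> p; move=> /[dup] /mem_embed[x [y ->]]; rewrite mem_embed_nat => /inP[? _ _ ?]; split.
Qed.

Lemma nw_path_profile c : convex c -> connected c -> wf_path (nw_path c) /\
  exists a T, has_profile c a (profile (nw_path c)) T.
Proof.
move=> cV cC; have : is_nw_path c (nw_path c).
  rewrite /nw_path; case: xgetP => // no.
  by have [s sP] := nw_path_exists cV cC; case: (no s).
case=> [P [Q [[b1 b1c [-> ne]] [b2 b2c [-> sw]]]]].
have [e [t Eb1]] := mem_embed b1c; have [a [b Eb2]] := mem_embed b2c; subst b1 b2.
rewrite mem_embed_nat in b1c; rewrite mem_embed_nat in b2c; rewrite /=.
have inP (x y : nat) : (x, y) \in c -> [/\ a <= x, x <= e, t <= y & y <= b].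
  by rewrite -mem_embed_nat => /[dup] /ne[? ?] /sw[? ?]; split.
have sw_min (x y : nat) : (x, y) \in c -> a <= x /\ y < b.+1 by case/inP.
have etop : is_top c e t by split=> // y' /inP[].
have -> : (e%:Z + 1 = e.+1%:Z)%R by lia.
have -> : (b%:Z + 1 = b.+1%:Z)%R by lia.
move: (nw_path c) => [|lv s] bp.
  by case: bp => E; have [] := inP _ _ b1c; lia.
have [wf sz [T [Ttop Tdrop Tov [T0 w0] Tlast]]] :=
  @boundary_profile c a b.+1 cV cC (ltn0Sn b) b2c sw_min (lv :: s) e t etop isT bp.
split=> //; exists a, T; split=> //.
- by have [] := inP _ _ b1c; lia.
- by move=> x y /inP[]; lia.
- have -> : T 0 + (nth 0 (profile (lv :: s)) 0).-1 = b by lia.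
  by [].
- by move=> x y /inP[]; lia.
Qed.

(** * Translations, and additions to a Ferrers diagram *)

(** The translation by the integer vector [(v1, v2)], read on natural coordinates. *)
Record translated_by (c d : diagram) (v1 v2 : int) : Prop := TranslatedBy {
  translated_mem : forall x y x' y' : nat, (x'%:Z = x%:Z + v1)%R -> (y'%:Z = y%:Z + v2)%R ->
    ((x', y') \in d) = ((x, y) \in c);
  translated_ge0 : forall x y : nat, (x, y) \in c -> (0 <= x%:Z + v1)%R /\ (0 <= y%:Z + v2)%R;
  translated_le : forall x y : nat, (x, y) \in d -> (v1 <= x%:Z)%R /\ (v2 <= y%:Z)%R }.

Lemma translatesP c d : translates c d <-> exists v1 v2, translated_by c d v1 v2.
Proof.
split=> [[[v1 v2] E]|[v1 [v2 [mem ge0 le]]]].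
  have memE (x y : nat) : (x, y) \in d -> exists x' y' : nat,
      [/\ (x', y') \in c, (x%:Z = x'%:Z + v1)%R & (y%:Z = y'%:Z + v2)%R].
    rewrite -mem_embed_nat -E => /imfsetP[p /= pc Ep].
    have [x' [y' Ep']] := mem_embed pc; exists x', y'; rewrite -mem_embed_nat -Ep' pc.
    by rewrite Ep' in Ep; case: Ep.
  have memE' (x y : nat) : (x, y) \in c -> (x%:Z + v1, y%:Z + v2)%R \in embed d.
    by rewrite -mem_embed_nat -E => xy; apply/imfsetP; exists (x%:Z, y%:Z)%R.
  exists v1, v2; split.
  - move=> x y x' y' Ex Ey; apply/idP/idP => [/memE[x2 [y2 [xy2 Ex2 Ey2]]]|/memE'].
      by have [-> ->] : x = x2 /\ y = y2 by lia.
    by rewrite -Ex -Ey mem_embed_nat.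
  - by move=> x y /memE'; rewrite mem_embedE => /and3P[].
  - by move=> x y /memE[x' [y' [_ -> ->]]]; lia.
exists (v1, v2); apply/fsetP => p; apply/imfsetP/idP => /= [[p' pc ->]|pd].
  have [x [y E]] := mem_embed pc; rewrite {}E mem_embed_nat in pc *.
  have [x0 y0] := ge0 _ _ pc; rewrite mem_embedE /= x0 y0 /= (mem x y)//; lia.
have [x [y E]] := mem_embed pd; rewrite {}E mem_embed_nat in pd *.
have [x0 y0] := le _ _ pd; exists (x%:Z - v1, y%:Z - v2)%R; last first.
  by apply: injective_projections; rewrite /= subrK.
rewrite mem_embedE /=; apply/and3P; split; [by lia|by lia|].
by rewrite -(mem _ _ x y) ?pd//; lia.
Qed.

Lemma absz_shift (x : nat) (v : int) : (0 <= x%:Z + v)%R -> ((`|(x%:Z + v)%R|%N)%:Z = x%:Z + v)%R.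
Proof. by lia. Qed.

Lemma translated_profile c d v1 v2 a w T : translated_by c d v1 v2 -> has_profile c a w T ->
  exists a' T', has_profile d a' w T'.
Proof.
move=> [mem ge0 le] [sz col top drop ov left bot row].
have [T0c _] := top 0 sz; rewrite addn0 in T0c; have [a0 _] := ge0 _ _ T0c.
pose a' := `|(a%:Z + v1)%R|%N; have a'E : (a'%:Z = a%:Z + v1)%R by exact: absz_shift.
pose T' i := `|((T i)%:Z + v2)%R|%N.
have T'E i : i < size w -> ((T' i)%:Z = (T i)%:Z + v2)%R.
  by move=> iw; apply: absz_shift; have [Tc _] := top i iw; have [] := ge0 _ _ Tc.
exists a', T'; split=> //.
- move=> x y xy; have [x0 y0] := le _ _ xy.
  have := col `|(x%:Z - v1)%R|%N `|(y%:Z - v2)%R|%N; rewrite -(mem _ _ x y); [|lia|lia].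
  by move=> /(_ xy); lia.
- move=> i iw; have [Tc Tmin] := top i iw; have E := T'E i iw; split.
    by rewrite (mem (a + i) (T i))//; lia.
  move=> y' xy'; have [x0 y0] := le _ _ xy'.
  have := Tmin `|(y'%:Z - v2)%R|%N; rewrite -(mem _ _ (a' + i) y'); [|lia|lia].
  by move=> /(_ xy'); lia.
- by move=> i iw; have := drop i iw; have := T'E _ iw; have := T'E _ (ltnW iw); lia.
- by move=> i iw; rewrite (mem (a + i.+1) (T i)) ?ov//; have := T'E _ (ltnW iw); lia.
- by rewrite (mem a (T 0 + (nth 0 w 0).-1))//; have := T'E _ sz; lia.
- move=> x y xy; have [x0 y0] := le _ _ xy.
  have := row `|(x%:Z - v1)%R|%N `|(y%:Z - v2)%R|%N; rewrite -(mem _ _ x y); [|lia|lia].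
  by move=> /(_ xy); have := T'E _ sz; lia.
Qed.

Lemma translated_convex c d v1 v2 : translated_by c d v1 v2 -> convex c -> convex d.
Proof.
move=> [mem ge0 le] cV x y x' y' x'' y'' xy xy'' xx yy.
have [x0 y0] := le _ _ xy; have [x0'' y0''] := le _ _ xy''.
rewrite (mem `|(x'%:Z - v1)%R|%N `|(y'%:Z - v2)%R|%N); [|lia|lia].
apply: (@convex_mem _ `|(x%:Z - v1)%R|%N `|(y%:Z - v2)%R|%N _ _
  `|(x''%:Z - v1)%R|%N `|(y''%:Z - v2)%R|%N) => //.
- by rewrite -(mem _ _ x y)//; lia.
- by rewrite -(mem _ _ x'' y'')//; lia.
- by lia.
- by lia.
Qed.

Lemma translated_connected c d v1 v2 : translated_by c d v1 v2 -> connected c -> connected d.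
Proof.
move=> cd [[[x0 y0] c0] cC]; have [mem ge0 le] := cd; split.
  have [x1 y1] := ge0 _ _ c0; exists (`|(x0%:Z + v1)%R|%N, `|(y0%:Z + v2)%R|%N).
  by rewrite (mem x0 y0)//; lia.
move=> P Pcl [x y] [x' y'] xy xy' Pxy.
have [xl yl] := le _ _ xy; have [xl' yl'] := le _ _ xy'.
pose Q (p : nat * nat) := P (`|(p.1%:Z + v1)%R|%N, `|(p.2%:Z + v2)%R|%N).
have Qcl : closed_in c Q.
  move=> [x1 y1] [x2 y2] xy1 xy2 adj; have [? ?] := ge0 _ _ xy1; have [? ?] := ge0 _ _ xy2.
  apply: Pcl; rewrite /=; [by rewrite (mem x1 y1)//; lia|by rewrite (mem x2 y2)//; lia|].
  by move: adj; rewrite /adjacent /=; lia.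
have := cC Q Qcl (`|(x%:Z - v1)%R|%N, `|(y%:Z - v2)%R|%N)
  (`|(x'%:Z - v1)%R|%N, `|(y'%:Z - v2)%R|%N).
have E (z : nat) (v : int) : (v <= z%:Z)%R -> `|((`|(z%:Z - v)%R|%N)%:Z + v)%R|%N = z by lia.
rewrite /Q /= !E// -(mem _ _ x y) -?(mem _ _ x' y'); try lia.
by apply.
Qed.

Lemma profile_left_unique c a w T a' w' T' :
  has_profile c a w T -> has_profile c a' w' T' -> a = a'.
Proof.
move=> p p'; have [c0 _] := profile_top p (profile_size p).
have [c0' _] := profile_top p' (profile_size p').
by have := profile_col p c0'; have := profile_col p' c0; lia.
Qed.

(** The translation fixes the leftmost column and the top of this column, so it is
the identity. *)
Lemma translated_eq c d w T T' j : translates c d -> has_profile c j w T ->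
  has_profile d j w T' -> T 0 = T' 0 -> c = d.
Proof.
move=> /translatesP[v1 [v2 tr]] p p' T0.
have [c0 ctop] := profile_top p (profile_size p).
have [d0 dtop] := profile_top p' (profile_size p').
rewrite addn0 in c0 ctop d0 dtop; have [mem ge0 le] := tr.
have [g1 g2] := ge0 _ _ c0; have [l1 l2] := le _ _ d0.
have d1 : (`|(j%:Z + v1)%R|%N, `|((T 0%N)%:Z + v2)%R|%N) \in d by rewrite (mem j (T 0))//; lia.
have c1 : (`|(j%:Z - v1)%R|%N, `|((T' 0%N)%:Z - v2)%R|%N) \in c.
  by rewrite -(mem _ _ j (T' 0))//; lia.
have v10 : v1 = 0%R.
  have := profile_col p' d1; have := profile_col p c1; lia.
subst v1; rewrite addr0 in d1; rewrite subr0 in c1.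
have v20 : v2 = 0%R by have := dtop _ d1; have := ctop _ c1; lia.
subst v2; apply/fsetP => -[x y]; symmetry; by apply: mem; rewrite addr0.
Qed.

(** Over the columns [j .. j + size w - 1], the boundary of [mu] follows a path of
profile [w]; at the west end it is allowed to go further south, which for
[j = 0] is always the case. *)
Definition fits (mu : diagram) (j : nat) (w : seq nat) :=
  (forall i, i.+1 < size w -> mult mu (j + i.+1) = nth 0 w i.+1) /\
  (0 < j -> nth 0 w 0 <= mult mu j).

(** What is added in a column has to start right below [mu]. *)
Lemma addable_top mu d j w T i : is_ferrers mu -> is_ferrers (mu `|` d)%fset ->
  (forall p, p \in d -> p \notin mu) -> has_profile d j w T -> i < size w ->
  height mu (j + i) = T i.
Proof.
move=> muF mudF disj p iw; have [di dmin] := profile_top p iw.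
have := disj _ di; rewrite mem_height// -leqNgt leq_eqVlt => /predU1P[//|lt].
have : (j + i, height mu (j + i)) \in (mu `|` d)%fset.
  by apply: (mudF _ (j + i, T i)) => //=; [rewrite !inE di orbT | exact: ltnW].
by rewrite !inE mem_height// ltnn /= => /dmin; rewrite leqNgt lt.
Qed.

(** The difference of consecutive tops is read on [mu] by [addable_top]. At the
west end, the west neighbour of the lowest box of [d] has to be in [mu]. *)
Lemma addable_fits mu d j w T : is_ferrers mu -> is_ferrers (mu `|` d)%fset ->
  (forall p, p \in d -> p \notin mu) -> has_profile d j w T -> fits mu j w.
Proof.
move=> muF mudF disj p; have topE i := @addable_top mu d j w T i muF mudF disj p.
split=> [i iw|j_gt0].
  have E : (j + i.+1).-1 = j + i by rewrite addnS.
  by rewrite /mult E (topE _ (ltnW iw)) (topE _ iw) (profile_drop p iw) addKn.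
have := topE 0 (profile_size p); rewrite addn0 /mult => ->.
have : (j.-1, T 0 + (nth 0 w 0).-1) \in (mu `|` d)%fset.
  apply: (mudF _ (j, T 0 + (nth 0 w 0).-1)) => //=; last exact: leq_pred.
  by rewrite !inE (profile_bot p) orbT.
rewrite !inE mem_height// => /orP[|/(profile_col p)]; last by lia.
by have := profile_left p; lia.
Qed.

(** The translation is chosen so that the leftmost column goes right below the
column [j] of [mu]. The other tops then agree, because the drops between
consecutive columns do. *)
Lemma place_exists mu c a w T j : is_ferrers mu -> convex c -> has_profile c a w T ->
  fits mu j w ->
  exists d, [/\ translates c d, is_ferrers (mu `|` d)%fset, forall p, p \in d -> p \notin mu &
    exists T', has_profile d j w T'].
Proof.
move=> muF cV p [fit fit0].
have hE i : i < size w -> height mu (j + i) + T 0 = T i + height mu j.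
  elim: i => [|i IH] iw; first by rewrite addn0 addnC.
  have := IH (ltnW iw); have := fit i iw; have := profile_drop p iw.
  have := heightS (j + i) muF; rewrite /mult -addnS (_ : (j + i.+1).-1 = j + i); last lia.
  by lia.
have colc x y : (x, y) \in c -> exists2 i, i < size w & x = a + i.
  by move=> /(profile_col p) xw; exists (x - a); lia.
(* No box is moved above the row [0], so the truncated subtraction in [d] is exact. *)
have topc x y : (x, y) \in c -> T 0 <= y + height mu j.
  move=> xy; have [i iw E] := colc _ _ xy; subst x.
  by have [_ /(_ _ xy)] := profile_top p iw; have := hE i iw; lia.
pose d : diagram := [fset (q.1 + j - a, q.2 + height mu j - T 0) | q in c]%fset.
have tr : translated_by c d (j%:Z - a%:Z)%R ((height mu j)%:Z - (T 0%N)%:Z)%R.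
  split.
  - move=> x y x' y' Ex Ey; apply/imfsetP/idP => /= [[[x1 y1] /= xy1 [E1 E2]]|xy].
      have := topc _ _ xy1; have := profile_col p xy1 => ? ?.
      by have [-> ->] : x = x1 /\ y = y1 by lia.
    by exists (x, y) => //=; congr pair; lia.
  - by move=> x y xy; have := topc _ _ xy; have := profile_col p xy; lia.
  - move=> x y /imfsetP[[x1 y1] /= xy1 [-> ->]].
    by have := topc _ _ xy1; have := profile_col p xy1; lia.
have d_row q : q \in d -> (height mu q.1 <= q.2) /\ exists2 i, i < size w & q.1 = j + i.
  move=> /imfsetP[[x1 y1] /= xy1 ->] /=; have [i iw E] := colc _ _ xy1; subst x1.
  have [_ /(_ _ xy1) y1T] := profile_top p iw; have hEi := hE i iw.
  have -> : a + i + j - a = j + i by lia.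
  by split; [lia | exists i].
have d_top i : i < size w -> (j + i, height mu (j + i)) \in d.
  move=> iw; have [ci _] := profile_top p iw; apply/imfsetP; exists (a + i, T i) => //=.
  by have := hE i iw => hEi; congr pair; lia.
have dV : convex d by exact: translated_convex tr cV.
have d_bot q : q \in d -> q.2 < height mu j + nth 0 w 0.
  move=> /imfsetP[[x1 y1] /= xy1 ->] /=; have := profile_row p xy1; have := topc _ _ xy1.
  by lia.
exists d; split.
- by apply/translatesP; exists (j%:Z - a%:Z)%R, ((height mu j)%:Z - (T 0%N)%:Z)%R.
- move=> [x' y'] [x y]; rewrite !in_fsetU => /orP[xy|xy] xx yy.
    by apply/orP; left; apply: (muF _ _ xy).
  have [//|nin] := boolP ((x', y') \in mu).
  have hy' : height mu x' <= y' by rewrite leqNgt -mem_height.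
  have [_ [i iw /= E]] := d_row _ xy; have yb := d_bot _ xy; rewrite /= in xx yy yb.
  have [jx'|x'j] := leqP j x'.
    have x'w : x' - j < size w by lia.
    have := d_top _ x'w; rewrite subnKC// => dt.
    by apply: (convex_mem dV dt xy); lia.
  have j_gt0 : 0 < j by lia.
  have hh : height mu j.-1 <= height mu x' by apply: height_anti => //; lia.
  by have := fit0 j_gt0; have := profile_left p; rewrite /mult; lia.
- by move=> [x y] /d_row[/=]; rewrite mem_height// -leqNgt.
- have [a' [T' p']] := translated_profile tr p.
  suff <- : a' = j by exists T'.
  have [d0 _] := profile_top p' (profile_size p').
  have [_ [i iw /= E]] := d_row _ d0.
  by have := profile_col p' (d_top _ (profile_size p)); lia.
Qed.

(** The column [a] of [has_profile], which is unique by [profile_left_unique]. *)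
Definition left_col (d : diagram) : nat :=
  xget 0 [set j | exists w T, has_profile d j w T]%classic.

Lemma left_colE d j w T : has_profile d j w T -> left_col d = j.
Proof.
move=> p; rewrite /left_col; case: xgetP => [j' _ [w' [T' p']]|/(_ j) no].
  exact: profile_left_unique p' p.
by case: no; exists w, T.
Qed.

(** * Adding all the components of a skew diagram *)

Lemma skew_diff_convex mu mu' : is_ferrers mu -> is_ferrers mu' -> convex (mu' `\` mu)%fset.
Proof. by move=> muF muF'; apply: skew_convex; exists mu, mu'. Qed.

(** A box that is weakly north-west of a box of [d] and outside [mu] is joined to it
by a staircase inside [mu' \ mu]. *)
Lemma component_addable mu mu' d : is_ferrers mu -> is_ferrers mu' -> (mu `<=` mu')%fset ->
  d \in components (mu' `\` mu)%fset -> is_ferrers (mu `|` d)%fset.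
Proof.
move=> muF muF' sub dC; have LV := skew_diff_convex muF muF'.
have /componentsP[dL dcon dcl] := dC.
move=> [x y] [x' y']; rewrite !in_fsetU => /orP[xy|xy] xx yy.
  by apply/orP; left; apply: (muF _ _ xy).
have [//|nin] := boolP ((x, y) \in mu).
have bL := dL _ xy; have aL : (x, y) \in (mu' `\` mu)%fset.
  by move: bL; rewrite !in_fsetD nin => /andP[_ b']; apply: (muF' _ _ b').
by have := convex_step LV dcl aL bL xx yy; rewrite /= => ->.
Qed.

Lemma component_disj mu mu' d p : d \in components (mu' `\` mu)%fset -> p \in d -> p \notin mu.
Proof. by move=> /componentsP[dL _ _] /dL; rewrite in_fsetD => /andP[]. Qed.

(** Two boxes of the same column are comparable. *)
Lemma components_same_col l c d (x y y' : nat) : convex l ->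
  c \in components l -> d \in components l -> (x, y) \in c -> (x, y') \in d -> c = d.
Proof.
move=> lV cC dC xy xy'; have /componentsP[cl _ ccl] := cC; have /componentsP[dl _ dcl] := dC.
have [yy|/ltnW yy] := leqP y y'.
  apply: (components_disj cC dC _ xy').
  by have := convex_step lV ccl (cl _ xy) (dl _ xy') (leqnn x) yy; rewrite /= xy.
apply: (components_disj cC dC xy).
by have := convex_step lV dcl (dl _ xy') (cl _ xy) (leqnn x) yy; rewrite /= xy'.
Qed.

Lemma component_profile l c : convex l -> c \in components l ->
  [/\ convex c, connected c, wf_path (nw_path c) &
  exists a T, has_profile c a (profile (nw_path c)) T].
Proof.
move=> lV cC; have cV := components_convex lV cC; have /componentsP[_ con _] := cC.
by have [wf pr] := nw_path_profile cV con; split.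
Qed.

Lemma size_profile s : wf_path s -> size (profile s) = nw_length s.
Proof.
rewrite /nw_length; elim: s => [|[l v] s IH] /=; first by rewrite big_nil.
case/andP=> /andP[/= l_gt0 _] /IH E; rewrite big_cons size_cat /= size_nseq E prednK// addnC.
by [].
Qed.

Section Places.
Variable l : diagram.
Hypothesis lV : convex l.
Let w (c : components l) := profile (nw_path (val c)).

(** The matching [f] is existential because [j] and [mu] determine it, by
[translated_eq]. *)
Definition places (j : {ffun components l -> nat}) (mu mu' : diagram) : Prop :=
  [/\ is_ferrers mu', (mu `<=` mu')%fset & exists f : components l -> diagram,
  [/\ injective f, forall c, translates (val c) (f c), forall c, left_col (f c) = j c &
      forall d, d \in components (mu' `\` mu)%fset <-> exists c, d = f c]].

Let cP (c : components l) : [/\ convex (val c), connected (val c), wf_path (nw_path (val c)) &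
  exists a T, has_profile (val c) a (w c) T].
Proof. exact: component_profile lV (valP c). Qed.

Let tr_profile (c : components l) d : translates (val c) d ->
  exists T, has_profile d (left_col d) (w c) T.
Proof.
move=> /translatesP[v1 [v2 tr]]; have [_ _ _ [a [T p]]] := cP c.
by have [a' [T' p']] := translated_profile tr p; exists T'; rewrite (left_colE p').
Qed.

Lemma interval_ofE (j : {ffun components l -> nat}) c t :
  interval_of j c t = (j c <= t < j c + size (w c)).
Proof. by have [_ _ wf _] := cP c; rewrite /w size_profile. Qed.

Lemma places_fits j mu mu' : is_ferrers mu -> places j mu mu' ->
  disjoint_tuples l j /\ forall c, fits mu (j c) (w c).
Proof.
move=> muF [muF' sub [f [finj ftr fleft fcomp]]].
have fC c : f c \in components (mu' `\` mu)%fset by apply/fcomp; exists c.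
split=> [c d cd t|c].
  apply/negP => /andP[]; rewrite !interval_ofE => tc td.
  have [T p] := tr_profile (ftr c); have [T' p'] := tr_profile (ftr d).
  rewrite !fleft in p p'.
  have [pc _] := profile_top p (i := t - j c) ltac:(lia).
  have [pd _] := profile_top p' (i := t - j d) ltac:(lia).
  rewrite subnKC in pc; last by lia.
  rewrite subnKC in pd; last by lia.
  have := components_same_col (skew_diff_convex muF muF') (fC c) (fC d) pc pd.
  by move/finj/eqP; rewrite (negPf cd).
have [T p] := tr_profile (ftr c); rewrite fleft in p.
apply: addable_fits p => //; first exact: component_addable sub (fC c).
by move=> q; exact: component_disj (fC c).
Qed.

(** Each component can be added alone by [place_exists], and a union of Ferrers
diagrams is a Ferrers diagram. The translates have no common column; they do not
touch either, because if a box of one is the east neighbour of a box of another,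
then the Ferrers condition puts both boxes in the same translate. *)
Lemma fits_places j mu : is_ferrers mu -> disjoint_tuples l j ->
  (forall c, fits mu (j c) (w c)) -> exists mu', places j mu mu'.
Proof.
move=> muF jdisj fit.
have H (c : components l) : exists d, [/\ translates (val c) d, is_ferrers (mu `|` d)%fset,
    forall p, p \in d -> p \notin mu & exists T', has_profile d (j c) (w c) T'].
  by have [cV _ _ [a [T p]]] := cP c; exact: place_exists muF cV p (fit c).
have {H}[f fP] := choice H.
have col_clash c c' x y y' : (x, y) \in f c -> (x, y') \in f c' -> c = c'.
  move=> xy xy'; apply/eqP; apply: contraT => /jdisj /(_ x).
  have [_ _ _ [T p]] := fP c; have [_ _ _ [T' p']] := fP c'.
  by rewrite !interval_ofE (profile_col p xy) (profile_col p' xy').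
pose L := (\bigcup_(c <- enum {: components l}) f c)%fset.
have LP p : reflect (exists c, p \in f c) (p \in L).
  apply: (iffP idP) => [/bigfcupP[c _ pc]|[c pc]]; first by exists c.
  by apply/bigfcupP; exists c => //; rewrite mem_enum.
have Lmu p : p \in L -> p \notin mu by move=> /LP[c pc]; have [_ _ + _] := fP c; apply.
have diffE : ((mu `|` L) `\` mu)%fset = L.
  apply/fsetP => p; rewrite in_fsetD in_fsetU; case pL : (p \in L); rewrite ?orbT ?orbF ?andbT.
    exact: Lmu.
  by rewrite andNb.
have fcon c : connected (f c).
  have [/translatesP[v1 [v2 tr]] _ _ _] := fP c; have [_ con _ _] := cP c.
  exact: translated_connected tr con.
have fne c : exists p, p \in f c by have [] := fcon c.
have fC c : f c \in components L.
  apply/componentsP; split; [by move=> p pc; apply/LP; exists c | exact: fcon | ].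
  (* Vertical neighbours share a column; horizontal ones are settled by the Ferrers
     condition for the translate of the east box. *)
  move=> [x y] [x' y'] /= _ /LP[c' bc'] adj ac.
  have [/andP[/eqP xx _]|] := boolP ((x == x') && true).
    by subst x'; rewrite (col_clash _ _ _ _ _ ac bc').
  rewrite andbT => ne; move: adj; rewrite /adjacent /= (negPf ne) /= => /andP[/eqP yy adj].
  subst y'; case/orP: adj => /eqP xx; last first.
    have [_ ddF _ _] := fP c.
    have : (x', y) \in (mu `|` f c)%fset.
      by apply: (ddF _ (x, y)); rewrite ?in_fsetU ?ac ?orbT //= -xx.
    rewrite in_fsetU => /orP[bmu|//]; have : (x', y) \in L by apply/LP; exists c'.
    by move/Lmu; rewrite bmu.
  have [_ ddF _ _] := fP c'.
  have : (x, y) \in (mu `|` f c')%fset.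
    by apply: (ddF _ (x', y)); rewrite ?in_fsetU ?bc' ?orbT //= -xx.
  rewrite in_fsetU => /orP[amu|ac'].
    by have : (x, y) \in L by [apply/LP; exists c]; move/Lmu; rewrite amu.
  by rewrite (col_clash _ _ _ _ _ ac ac').
exists (mu `|` L)%fset; split.
- move=> a b; rewrite !in_fsetU => /orP[bmu|/LP[c bc]] h1 h2; first by rewrite (muF _ _ bmu).
  have [_ ddF _ _] := fP c; have : a \in (mu `|` f c)%fset.
    by apply: (ddF _ b) => //; rewrite in_fsetU bc orbT.
  rewrite in_fsetU => /orP[->//|ac]; apply/orP; right; apply/LP; by exists c.
- exact: fsubsetUl.
- exists f; split.
  + move=> c c' E; have [[x y] pc] := fne c; apply: (col_clash _ _ _ _ _ pc).
    by rewrite -E; exact: pc.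
  + by move=> c; have [] := fP c.
  + by move=> c; have [_ _ _ [T p]] := fP c; exact: left_colE p.
  + rewrite diffE => d; split=> [dC|[c ->] //].
    have /componentsP[dL [[p pd] _] _] := dC.
    have /LP[c pc] := dL _ pd; exists c; exact: components_disj dC (fC c) pd pc.
Qed.

Lemma places_unique j mu mu1 mu2 : is_ferrers mu ->
  places j mu mu1 -> places j mu mu2 -> mu1 = mu2.
Proof.
move=> muF.
suff H m1 m2 : places j mu m1 -> places j mu m2 -> (m1 `<=` m2)%fset.
  by move=> p1 p2; apply/eqP; rewrite eqEfsubset !H.
move=> [F1 s1 [f [finj ftr fleft fcomp]]] [F2 s2 [g [ginj gtr gleft gcomp]]].
have E c : f c = g c.
  have [T p] := tr_profile (ftr c); have [T' p'] := tr_profile (gtr c).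
  rewrite fleft in p; rewrite gleft in p'.
  have fC : f c \in components (m1 `\` mu)%fset by apply/fcomp; exists c.
  have gC : g c \in components (m2 `\` mu)%fset by apply/gcomp; exists c.
  apply: (translated_eq _ p p'); first exact: translates_trans (translates_sym (ftr c)) (gtr c).
  have := addable_top muF (component_addable muF F1 s1 fC)
    (fun q => @component_disj _ _ _ q fC) p (profile_size p).
  have := addable_top muF (component_addable muF F2 s2 gC)
    (fun q => @component_disj _ _ _ q gC) p' (profile_size p').
  by move=> -> ->.
apply/fsubsetP => p p1; have [pmu|pmu] := boolP (p \in mu); first exact: (fsubsetP s2).
have pL : p \in (m1 `\` mu)%fset by rewrite in_fsetD pmu.
have [d dC pd] := components_cover pL; have /fcomp[c Ed] := dC.
have /componentsP[gL _ _] : g c \in components (m2 `\` mu)%fset by apply/gcomp; exists c.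
by have := gL p; rewrite -E -Ed in_fsetD => /(_ pd) /andP[].
Qed.

End Places.

(** * Counting the placements that give the same pair *)

Section ColouredSelections.
Variables (T K : eqType) (col : T -> K).

Fixpoint selections (ks : seq K) (A : seq T) : seq (seq T) :=
  if ks is k :: ks' then
    flatten [seq [seq a :: t | t <- selections ks' (rem a A)] | a <- A & col a == k]
  else [:: [::]].

Lemma mem_selections ks A t : uniq A ->
  (t \in selections ks A) = [&& uniq t, all (mem A) t & [seq col a | a <- t] == ks].
Proof.
elim: ks A t => [|k ks IH] A t A_uniq; first by case: t => [|a t]; rewrite ?inE ?andbF.
apply/flatten_mapP/and3P => [[a]|].
  rewrite mem_filter => /andP[/eqP ak aA] /mapP[t'].
  rewrite IH ?rem_uniq// => /and3P[t'u t'A /eqP tk] ->.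
  split=> /=; last by rewrite ak tk.
    rewrite t'u andbT; apply/negP => /(allP t'A) /=; rewrite mem_rem_uniq// !inE eqxx //.
  by rewrite aA; apply/allP => b /(allP t'A) /= /mem_rem.
case: t => [|a t] /= [u aA ka]; first by case/eqP: ka.
move: u aA => /andP[at_ t_uniq] /andP[aA tA]; case/eqP: ka => ak tk.
exists a; first by rewrite mem_filter ak eqxx.
apply/mapP; exists t => //; rewrite IH ?rem_uniq// t_uniq tk eqxx andbT.
apply/allP => b bt; have bA : b \in A := allP tA _ bt.
rewrite /= mem_rem_uniq// !inE bA andbT.
by apply: contraNneq at_ => <-.
Qed.

Lemma cons_flatten_uniq (F : T -> seq (seq T)) s : uniq s -> (forall a, a \in s -> uniq (F a)) ->
  uniq (flatten [seq [seq a :: t | t <- F a] | a <- s]).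
Proof.
elim: s => //= a s IH /andP[a_s s_uniq] Fu; rewrite cat_uniq IH// => [|b bs]; last first.
  by rewrite Fu// inE bs orbT.
rewrite andbT map_inj_uniq ?Fu ?mem_head//= => [|t t' []//].
apply/hasPn => _ /flatten_mapP[b bs /mapP[t _ ->]]; apply/mapP => -[t' _ [E _]].
by rewrite -E bs in a_s.
Qed.

Lemma selections_uniq ks A : uniq A -> uniq (selections ks A).
Proof.
elim: ks A => [//|k ks IH] A A_uniq /=; apply: cons_flatten_uniq; first exact: filter_uniq.
by move=> a _; apply: IH; exact: rem_uniq.
Qed.

Lemma count_rem_uniq (A : seq T) a k : a \in A ->
  count (fun b => col b == k) (rem a A) = count (fun b => col b == k) A - (col a == k).
Proof. by move=> aA; rewrite count_rem aA. Qed.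

(** Each choice of an element of colour [k] leaves one element less for the later
choices of that colour, whence the falling factorials. *)
Lemma size_selections (K0 ks : seq K) A : uniq K0 -> {subset ks <= K0} ->
  size (selections ks A) = \prod_(k <- K0) (count (fun b => col b == k) A) ^_ (count_mem k ks).
Proof.
move=> K0_uniq; elim: ks A => [|k ks IH] A sub; first by rewrite /= big1.
rewrite /= size_flatten /shape -map_comp sumnE big_map big_filter.
have kK0 : k \in K0 by apply: sub; rewrite mem_head.
have {}IH B := IH B (fun x xk => sub x (@mem_behead _ (k :: ks) _ xk)).
pose N := count (fun b => col b == k) A.
pose X := N.-1 ^_ (count_mem k ks) *
  \prod_(k' <- K0 | k' != k) (count (fun b => col b == k') A) ^_ (count_mem k' ks).
rewrite big_seq_cond (eq_bigr (fun=> X)) => [|a /andP[aA /eqP ak]]; last first.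
  rewrite /= size_map IH (bigD1_seq k)//= count_rem_uniq// ak eqxx subn1.
  congr (_ * _); apply: eq_bigr => k' kk'; rewrite count_rem_uniq// ak eq_sym (negPf kk') subn0.
  by [].
rewrite -big_seq_cond big_const_seq iter_addn_0 mulnC.
rewrite [RHS](bigD1_seq k)//= eqxx ffactnS -mulnA; congr (_ * (_ * _)).
by apply: eq_bigr => k' kk'; rewrite eq_sym (negPf kk').
Qed.
End ColouredSelections.

Fact skew0_subproof : `[< Defs.is_skew fset0 >].
Proof. by apply/asboolP; exists fset0, fset0; split=> [a b|a b|]; rewrite ?inE// fsetDv. Qed.
Definition skew0 : skew_diagram := Skew skew0_subproof.

(** The class of [d] when [d] is skew, and otherwise that of the empty diagram. *)
Definition kind (d : diagram) : skew_class := \pi_(skew_class)%qT (insubd skew0 d).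

Lemma kind_eqE c (rho : skew_class) : Defs.is_skew c ->
  (kind c == rho) = `[< skew_equiv c (skew_val (repr rho)) >].
Proof.
move=> cS; have valc : skew_val (insubd skew0 c) = c by apply: insubdK; exact/asboolP.
rewrite -{1}[rho]reprK; apply/eqP/asboolP.
  by move/eqmodP => /asboolP; rewrite valc.
by move=> E; apply/eqmodP/asboolP; rewrite valc.
Qed.

Lemma kind_eq c d : Defs.is_skew c -> Defs.is_skew d -> kind c = kind d <-> skew_equiv c d.
Proof.
move=> cS dS.
have vc : skew_val (insubd skew0 c) = c by apply: insubdK; exact/asboolP.
have vd : skew_val (insubd skew0 d) = d by apply: insubdK; exact/asboolP.
split=> [/eqmodP/asboolP|E]; first by rewrite vc vd.
by apply/eqmodP/asboolP; rewrite vc vd.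
Qed.

(** A connected diagram is its only component. *)
Lemma skew_equiv_connected c d : connected c -> connected d ->
  skew_equiv c d <-> translates c d.
Proof.
have inC m x : connected m -> x \in components m -> x = m.
  by move=> mC; rewrite components_connected// inE => /eqP.
have mem m : connected m -> m \in components m by move=> mC; rewrite components_connected// inE.
move=> cC dC; have cc := mem _ cC; have dd := mem _ dC; split=> [[f _ ft]|cd].
  by have := ft [` cc]%fset; rewrite (inC _ _ dC (valP (f [` cc]%fset))).
have cE (x : components c) : x = [` cc]%fset by apply: val_inj; exact: (inC _ _ cC (valP x)).
have dE (x : components d) : x = [` dd]%fset by apply: val_inj; exact: (inC _ _ dC (valP x)).
exists (fun=> [` dd]%fset) => [|x]; last by rewrite (cE x).
by exists (fun=> [` cc]%fset) => x; rewrite ?(cE x) ?(dE x).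
Qed.

Lemma component_skew m d : convex m -> d \in components m -> Defs.is_skew d.
Proof. by move=> mV dC; apply: convex_skew; exact: components_convex dC. Qed.

Section CountPlaces.
Variables (l : diagram) (lV : convex l).
Let kinds := [seq kind (val c) | c <- enum {: components l}].

Lemma kind_translates m c d : convex m -> c \in components l -> d \in components m ->
  kind c = kind d <-> translates c d.
Proof.
move=> mV cC dC; rewrite kind_eq; [|exact: component_skew cC|exact: component_skew dC].
by apply: skew_equiv_connected; [have /componentsP[] := cC | have /componentsP[] := dC].
Qed.

Lemma count_kinds rho : count_mem rho kinds = class_mult rho l.
Proof.
rewrite /class_mult count_map cardE [in RHS]/enum_mem size_filter enumT.
by apply: eq_count => c; rewrite /= inE kind_eqE//; exact: component_skew (valP c).
Qed.

(** Only the classes of the components of [l] contribute a factor other than [1]. *)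
Lemma mult_factE : mult_fact l = \prod_(rho <- undup kinds) (count_mem rho kinds)`!.
Proof.
rewrite /mult_fact (@fsbigE _ _ _ _ _ (undup kinds)) ?undup_uniq//=.
- by rewrite big_mkcond; apply: eq_bigr => rho _; rewrite mem_set// count_kinds.
- move=> rho _; rewrite mem_undup => nk.
  by rewrite -count_kinds (count_memPn nk).
Qed.

Lemma equiv_count_kind m rho : skew_equiv l m -> convex m ->
  count (fun b => kind b == rho) (components m) = count_mem rho kinds.
Proof.
move=> [f bf ft] mV; have [g fK gK] := bf.
rewrite /kinds count_map.
have -> : (components m : seq diagram) = [seq val d | d <- enum {: components m}].
  by rewrite enum_fsetE.
rewrite count_map -!size_filter.
have pe : perm_eq (enum {: components m}) [seq f c | c <- enum {: components l}].
  apply: uniq_perm; [exact: enum_uniq|by rewrite (map_inj_uniq (can_inj fK)) enum_uniq|].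
  by move=> d; rewrite mem_enum inE; symmetry; apply/mapP; exists (g d); rewrite ?mem_enum.
rewrite (perm_size (perm_filter _ pe)) filter_map size_map; congr size; apply: eq_filter => c /=.
congr (_ == _); apply/esym/(kind_translates mV); [exact: valP | exact: valP | exact: ft].
Qed.

(** Distinct components of [mu' \ mu] have no common column, so a placement amounts
to the choice, for each component of [l], of a component of [mu' \ mu] of the same
class, without repetition. As there are as many components of each class on both
sides, the falling factorials of [size_selections] are factorials. *)
Lemma places_list mu mu' : is_ferrers mu -> is_ferrers mu' -> (mu `<=` mu')%fset ->
  skew_equiv l (mu' `\` mu)%fset ->
  exists js : seq {ffun components l -> nat},
    [/\ uniq js, size js = mult_fact l & forall j, j \in js <-> places j mu mu'].
Proof.
move=> muF muF' sub eqv; set m := (mu' `\` mu)%fset in eqv *.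
have mV : convex m by exact: skew_diff_convex.
have C_uniq : uniq (components m) by exact: fset_uniq.
pose sel := selections kind kinds (components m).
have selE t := mem_selections kind kinds t C_uniq.
(* The tuple of leftmost columns of the components selected in [t]. *)
pose J (t : seq diagram) : {ffun components l -> nat} :=
  [ffun c => left_col (nth fset0 t (index c (enum {: components l})))].
have szt t : t \in sel -> size t = size (enum {: components l}).
  by rewrite selE => /and3P[_ _ /eqP E]; rewrite -(size_map kind) E size_map.
have cardE : size (components m) = size (enum {: components l}).
  case: (eqv) => f bf _; have := bij_eq_card bf; rewrite !cardE => ->.
  by rewrite [in LHS]enum_fsetE size_map.
have fset_of t : t \in sel -> forall d, d \in components m -> d \in t.
  rewrite selE => /and3P[tu /allP tA /eqP tk] d dm.
  have [] := @uniq_min_size _ t (components m) tu tA.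
    rewrite cardE -[leqLHS](size_map (fun c : components l => kind (val c))).
    by rewrite -/kinds -tk size_map.
  by move=> _ /(_ d); rewrite dm => ->.
pose F (t : seq diagram) (c : components l) := nth fset0 t (index c (enum {: components l})).
have idx c : index c (enum {: components l}) < size (enum {: components l}).
  by rewrite index_mem mem_enum.
have FP t : t \in sel -> [/\ injective (F t), forall c, F t c \in components m,
    forall c, kind (F t c) = kind (val c) & t = [seq F t c | c <- enum {: components l}]].
  move=> ts; have sz := szt _ ts; move: ts; rewrite selE => /and3P[tu /allP tA /eqP tk].
  split.
  - move=> c c' /eqP; rewrite nth_uniq ?sz ?idx// => /eqP E.
    by have := congr1 (nth c (enum {: components l})) E; rewrite !nth_index ?mem_enum.
  - by move=> c; apply: tA; rewrite mem_nth// sz.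
  - move=> c; have := congr1 (fun s => nth (kind fset0) s (index c (enum {: components l}))) tk.
    rewrite (nth_map fset0) ?sz ?idx// (nth_map c) ?idx// nth_index//.
    by rewrite mem_enum.
  - apply: (@eq_from_nth _ fset0); [by rewrite size_map sz | move=> i; rewrite sz => it].
    case E: (enum {: components l}) it => [//|c0 r]; rewrite -E => it.
    by rewrite (nth_map c0)// /F index_uniq ?enum_uniq.
exists [seq J t | t <- sel]; split.
- rewrite map_inj_in_uniq ?selections_uniq// => t t' ts ts' E.
  have [_ Ft _ ->] := FP _ ts; have [_ Ft' _ ->] := FP _ ts'; apply: eq_map => c.
  have := congr1 (fun j : {ffun _ -> _} => j c) E; rewrite !ffunE -/(F t c) -/(F t' c) => Ec.
  have [_ _ _ [a [T p]]] := component_profile mV (Ft c).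
  have [_ _ _ [a' [T' p']]] := component_profile mV (Ft' c).
  rewrite (left_colE p) (left_colE p') in Ec; subst a'.
  have [c1 _] := profile_top p (profile_size p); have [c2 _] := profile_top p' (profile_size p').
  by rewrite !addn0 in c1 c2; exact: components_same_col mV (Ft c) (Ft' c) c1 c2.
- rewrite size_map (@size_selections _ _ _ (undup kinds)) ?undup_uniq//; last first.
    by move=> k; rewrite mem_undup.
  rewrite mult_factE; apply: eq_bigr => rho _.
  by rewrite equiv_count_kind// ffactnn.
- move=> j; split=> [/mapP[t ts ->]|[_ _ [f [finj ftr fleft fcomp]]]].
    have [Finj Fm Fk tE] := FP _ ts; split=> //; exists (F t); split=> //.
    + by move=> c; apply/(kind_translates mV); rewrite ?Fk //; exact: valP.
    + by move=> c; rewrite ffunE.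
    + move=> d; split=> [dm|[c ->] //].
      have := fset_of _ ts _ dm; rewrite {1}tE => /mapP[c _ ->]; by exists c.
  have fm c : f c \in components m by apply/fcomp; exists c.
  apply/mapP; exists [seq f c | c <- enum {: components l}].
    rewrite selE map_inj_uniq ?enum_uniq//=; apply/andP; split.
      by apply/allP => _ /mapP[c _ ->]; exact: fm.
    apply/eqP; rewrite /kinds -map_comp; apply: eq_map => c /=.
    by apply/esym/(kind_translates mV); [exact: valP|exact: fm|exact: ftr].
  by apply/ffunP => c; rewrite ffunE (nth_map c) ?idx// nth_index ?mem_enum.
Qed.

Lemma places_equiv (j : {ffun components l -> nat}) mu mu' :
  places j mu mu' -> skew_equiv l (mu' `\` mu)%fset.
Proof.
move=> [_ _ [f [finj ftr _ fcomp]]].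
have fm c : f c \in components (mu' `\` mu)%fset by apply/fcomp; exists c.
pose g (c : components l) : components (mu' `\` mu)%fset := [` fm c]%fset.
exists g; last exact: ftr.
have ex (d : components (mu' `\` mu)%fset) : exists c, f c == val d.
  by have /fcomp[c E] := valP d; exists c; rewrite E.
exists (fun d => xchoose (ex d)) => [c|d].
  by apply: finj; apply/eqP; exact: (xchooseP (ex (g c))).
by apply: val_inj; apply/eqP; exact: (xchooseP (ex d)).
Qed.
End CountPlaces.

Local Open Scope ring_scope.

Local Notation mon := {cmonom (nat * nat)%type}.

(** * Formal derivatives of polynomials *)

Lemma dyEw (j h : nat) (d : {fset mon}) (g : ypoly) : (msupp g `<=` d)%fset ->
  dy j h g = \sum_(m <- d) << g@_m *+ m (j, h) *g divcm m (ucm (j, h)) >>.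
Proof.
move=> le; rewrite /dy (big_fset_incl _ le)// => m _.
by rewrite -mcoeff_eq0 => /eqP ->; rewrite mul0rn monalgU0.
Qed.

Lemma dyB j h (f g : ypoly) : dy j h (f - g) = dy j h f - dy j h g.
Proof.
rewrite !(@dyEw j h (msupp f `|` msupp g)%fset) ?fsubsetUl ?fsubsetUr ?msuppB_le//.
rewrite -sumrB; apply: eq_bigr => m _.
by rewrite mcoeffB mulrnBl monalgUB.
Qed.

HB.instance Definition _ j h := GRing.isZmodMorphism.Build ypoly ypoly (dy j h) (@dyB j h).

Lemma dyU j h c m : dy j h << c *g m >> = << c *+ m (j, h) *g divcm m (ucm (j, h)) >>.
Proof. by rewrite (dyEw _ _ (@msuppU_le _ _ m c)) big_seq_fset1 mcoeffUU. Qed.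

Lemma dyZ j h c g : dy j h (c *: g) = c *: dy j h g.
Proof.
rewrite (dyEw _ _ (msuppZ_le c g)) scaler_sumr; apply: eq_bigr => m _.
apply/malgP => k; rewrite mcoeffZ mcoeffU mcoeffZ mcoeffU.
by rewrite !mulrnAr.
Qed.

Lemma malg_ind (P : ypoly -> Prop) : (forall f g, P f -> P g -> P (f + g)) -> P 0 ->
  (forall c m, P << c *g m >>) -> forall g, P g.
Proof. by move=> PD P0 PU g; rewrite [g]monalgE; elim/big_rec: _ => // m f _; exact: PD. Qed.

Lemma leibniz_addl (A : nzRingType) (D : {additive A -> A}) (f1 f2 g : A) :
  D (f1 * g) = D f1 * g + f1 * D g -> D (f2 * g) = D f2 * g + f2 * D g ->
  D ((f1 + f2) * g) = D (f1 + f2) * g + (f1 + f2) * D g.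
Proof. by move=> E1 E2; rewrite mulrDl !raddfD E1 E2 !mulrDl addrACA. Qed.

Lemma leibniz_addr (A : nzRingType) (D : {additive A -> A}) (f g1 g2 : A) :
  D (f * g1) = D f * g1 + f * D g1 -> D (f * g2) = D f * g2 + f * D g2 ->
  D (f * (g1 + g2)) = D f * (g1 + g2) + f * D (g1 + g2).
Proof. by move=> E1 E2; rewrite mulrDr !raddfD E1 E2 !mulrDr addrACA. Qed.

Lemma leibniz0l (A : nzRingType) (D : {additive A -> A}) (g : A) :
  D (0 * g) = D 0 * g + 0 * D g.
Proof. by rewrite !(mul0r, raddf0, addr0). Qed.

Lemma leibniz0r (A : nzRingType) (D : {additive A -> A}) (g : A) :
  D (g * 0) = D g * 0 + g * D 0.
Proof. by rewrite !(mulr0, raddf0, addr0). Qed.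

Lemma malgMUU (c d : fps rat) (m p : mon) :
  << c *g m >> * << d *g p >> = << c * d *g mmul m p >> :> ypoly.
Proof. by rewrite malgM_def; exact: fgmulUU. Qed.

Lemma eq_malgU (c c' : fps rat) (m m' : mon) :
  c = c' -> m =1 m' -> << c *g m >> = << c' *g m' >> :> ypoly.
Proof. by move=> -> /cmP/eqP ->. Qed.

(** By linearity it is enough to consider monomials, where the rule says that
exponents add up. Truncation in the quotients of monomials is harmless: it only
happens in terms whose coefficient is [0]. *)
Lemma dyM j h (f g : ypoly) : dy j h (f * g) = dy j h f * g + f * dy j h g.
Proof.
move: g; elim/malg_ind: f => [f1 f2 IH1 IH2 g|g|c m g].
- exact: (@leibniz_addl _ (dy j h) _ _ _ (IH1 g) (IH2 g)).
- exact: (@leibniz0l _ (dy j h)).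
elim/malg_ind: g => [g1 g2 IH1 IH2||d p].
- exact: (@leibniz_addr _ (dy j h) _ _ _ IH1 IH2).
- exact: (@leibniz0r _ (dy j h)).
apply: (etrans (congr1 (dy j h) (malgMUU c d m p))).
apply: (etrans (dyU j h (c * d) (mmul m p))).
apply: esym.
have E2 := etrans (congr1 (fun a : ypoly => a * << d *g p >>) (dyU j h c m)) (malgMUU _ d _ p).
have E3 := etrans (congr1 (fun a : ypoly => << c *g m >> * a) (dyU j h d p)) (malgMUU c _ m _).
apply: (etrans (congr2 (@GRing.add ypoly) E2 E3)).
rewrite cmM mulrnDr.
rewrite monalgUD.
apply: congr2.
  have [->|m0] := eqVneq (m (j, h)) 0%N; first by rewrite !mulr0n mul0r !monalgU0.
  apply: eq_malgU => [|i]; first by rewrite mulrnAl.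
  rewrite !(divcmE, cmM) ucmE; case: eqP => [<-|_]; last by rewrite !subn0.
  by rewrite addnBAC ?lt0n.
have [->|m0] := eqVneq (p (j, h)) 0%N; first by rewrite !mulr0n mulr0 !monalgU0.
apply: eq_malgU => [|i]; first by rewrite mulrnAr.
rewrite !(divcmE, cmM) ucmE; case: eqP => [<-|_]; last by rewrite !subn0.
by rewrite -addnBA ?lt0n.
Qed.

Lemma comm_addl (A : nzRingType) (D D' : {additive A -> A}) (f g : A) :
  D (D' f) = D' (D f) -> D (D' g) = D' (D g) -> D (D' (f + g)) = D' (D (f + g)).
Proof. by move=> E1 E2; rewrite !raddfD E1 E2. Qed.

Lemma comm0 (A : nzRingType) (D D' : {additive A -> A}) : D (D' 0) = D' (D 0).
Proof. by rewrite !raddf0. Qed.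

Lemma dyUU j h j' h' c m : j != j' -> dy j h (dy j' h' << c *g m >>) =
  << c *+ m (j', h') *+ m (j, h) *g divcm (divcm m (ucm (j', h'))) (ucm (j, h)) >>.
Proof.
move=> ne; apply: (etrans (congr1 (dy j h) (dyU j' h' c m))).
apply: (etrans (dyU _ _ _ _)); apply: eq_malgU => //.
rewrite divcmE ucmE.
have -> : (j', h') == (j, h) = false by apply/eqP => -[/esym/eqP]; rewrite (negPf ne).
by rewrite subn0.
Qed.

Lemma dyC j h j' h' (g : ypoly) : j != j' -> dy j h (dy j' h' g) = dy j' h' (dy j h g).
Proof.
move=> ne; elim/malg_ind: g => [f g IH1 IH2||c m].
- exact: (@comm_addl _ (dy j h) (dy j' h') _ _ IH1 IH2).
- exact: (@comm0 _ (dy j h) (dy j' h')).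
apply: (etrans (dyUU _ _ _ _ ne)); apply: esym; rewrite eq_sym in ne.
apply: (etrans (dyUU _ _ _ _ ne)); apply: eq_malgU => [|i]; first by rewrite mulrnAC.
by rewrite !divcmE subnAC.
Qed.

Definition one_mon (m : mon) : fps rat := 1.
Fact one_mon_mmorphism : mmorphism one_mon.
Proof. by split=> // x y; rewrite mulr1. Qed.
HB.instance Definition _ := isMultiplicative.Build mon (fps rat) one_mon one_mon_mmorphism.

Definition eval_at1 : {rmorphism ypoly -> fps rat} := mmap idfun one_mon.

Lemma eval1E g : eval1 g = eval_at1 g.
Proof. by []. Qed.

Lemma eval_at1Z c g : eval_at1 (c *: g) = c * eval_at1 g.
Proof. exact: (@mmapZ _ _ _ idfun one_mon). Qed.

Lemma eval_at1_yvar j h : eval_at1 (yvar j h) = 1.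
Proof. by apply: (etrans (@mmapU _ _ _ idfun one_mon _ _)); rewrite /=; rewrite mulr1. Qed.
Lemma eval_at1_dy_yvar j h j' h' : eval_at1 (dy j h (yvar j' h')) = ((j, h) == (j', h'))%:R.
Proof.
apply: (etrans (congr1 eval_at1 (dyU _ _ _ _))).
apply: (etrans (@mmapU _ _ _ idfun one_mon _ _)); rewrite /=.
by rewrite mulr1 ucmE eq_sym.
Qed.

(** * Operators attached to distinct abscissas *)

Lemma big_op_comp (I : Type) (r : seq I) (F : I -> ypoly -> ypoly) (g : ypoly) :
  (\big[op_comp/id]_(i <- r) F i) g = foldr F g r.
Proof. by elim: r => [|i r IH]; rewrite ?big_nil ?big_cons //= /op_comp /= IH. Qed.

Section ColumnOperators.
Variables (A B : comNzRingType) (d : nat -> nat -> {additive A -> A}).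
Variable e : {rmorphism A -> B}.
Hypothesis dM : forall x h f g, d x h (f * g) = d x h f * g + f * d x h g.
Hypothesis dC : forall x h x' h' g, x != x' -> d x h (d x' h' g) = d x' h' (d x h g).

(** The bracket of [S_I] at the abscissa [o.1.1], for a south run of length
[o.1.2]; the boolean [o.2] tells whether this run may not be longer. *)
Definition act (o : nat * nat * bool) (g : A) : A :=
  d o.1.1 o.1.2 g - d o.1.1 o.1.2.+1 g *+ o.2.

(** For polynomials, this says that only variables of first index [x] occur. *)
Definition lives_in (x : nat) (g : A) := forall x' h, x' != x -> d x' h g = 0.

Lemma act_mul o f g : (forall h, d o.1.1 h f = 0) -> act o (f * g) = f * act o g.
Proof. by move=> f0; rewrite /act !dM !f0 !mul0r !add0r mulrBr mulrnAr. Qed.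

Lemma lives_in_act o x g : lives_in x g -> lives_in x (act o g).
Proof.
move=> gx x' h ne; have K k : d x' h (d o.1.1 k g) = 0.
  have [E|ne'] := eqVneq o.1.1 x; last by rewrite gx// raddf0.
  by rewrite E dC// gx// raddf0.
by rewrite /act raddfB raddfMn !K mul0rn subr0.
Qed.

Definition run (os : seq (nat * nat * bool)) (g : A) : A := foldr act g os.

Lemma act_prod o N (Phi : nat -> A) : (forall x, lives_in x (Phi x)) -> (o.1.1 < N)%N ->
  act o (\prod_(x < N) Phi x) =
  \prod_(x < N) (if x == o.1.1 :> nat then act o (Phi x) else Phi x).
Proof.
move=> PhiP oN; pose x0 := Ordinal oN.
rewrite (bigD1 x0)//= mulrC act_mul; last first.
  move=> h; elim/big_rec: _ => [|i g ine IH].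
    have := dM o.1.1 h 1 1; rewrite !mulr1 mul1r.
    by move/eqP; rewrite -subr_eq subrr eq_sym => /eqP.
  by rewrite dM IH mulr0 addr0 PhiP ?mul0r// eq_sym; move: ine; rewrite -val_eqE.
rewrite [RHS](bigD1 x0)//= eqxx mulrC; congr (_ * _).
by apply: eq_bigr => i; rewrite -val_eqE /= => /negPf ->.
Qed.

(** Each operator acts on one factor only, and differently indexed ones on
different factors, so the value of the product is the product of local values. *)
Lemma run_prod os N (Phi : nat -> A) (G : nat -> B) :
  (forall x, lives_in x (Phi x)) -> all (fun o => o.1.1 < N)%N os ->
  uniq [seq o.1.1 | o <- os] ->
  (forall o, o \in os -> e (act o (Phi o.1.1)) = G o.1.1) ->
  (forall x, (x < N)%N -> x \notin [seq o.1.1 | o <- os] -> e (Phi x) = G x) ->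
  e (run os (\prod_(x < N) Phi x)) = \prod_(x < N) G x.
Proof.
move=> PhiP osN os_uniq Gact Gid.
(* [upd os x] is the factor of index [x] after the action of [os]. *)
pose upd := fix upd os (x : nat) := if os is o :: os' then
  if x == o.1.1 then act o (upd os' x) else upd os' x else Phi x.
have updP os' x : lives_in x (upd os' x).
  by elim: os' => //= o os' IH; case: ifP => // _; exact: lives_in_act.
have upd_id os' x : x \notin [seq o.1.1 | o <- os'] -> upd os' x = Phi x.
  by elim: os' => //= o os' IH; rewrite inE negb_or => /andP[/negPf -> /IH].
have upd_act os' o : uniq [seq o.1.1 | o <- os'] -> o \in os' ->
    upd os' o.1.1 = act o (Phi o.1.1).
  elim: os' => //= o' os' IH /andP[o'N uniq_os']; rewrite inE => /orP[/eqP ->|ois].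
    by rewrite eqxx upd_id.
  case: eqP => E; last exact: IH.
  by move: o'N; rewrite -E (map_f (fun o => o.1.1) ois).
have runE os' : all (fun o => o.1.1 < N)%N os' ->
    run os' (\prod_(x < N) Phi x) = \prod_(x < N) upd os' x.
  elim: os' => //= o os' IH /andP[oN /IH ->]; rewrite act_prod//.
rewrite runE// rmorph_prod; apply: eq_bigr => i _.
have [/mapP[o ois E]|ni] := boolP (val i \in [seq o.1.1 | o <- os]).
  by rewrite E upd_act// Gact.
by rewrite upd_id// Gid.
Qed.

End ColumnOperators.

Definition dy_additive j h : {additive ypoly -> ypoly} := dy j h.

(** * The operators of a north-west path *)

(** The operators of [S_op] from east to west. The abscissas that a west run
crosses get the operator of a south run of length [0]. *)
Fixpoint path_ops (s : seq (nat * nat)) (j : nat) : seq (nat * nat * bool) :=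
  if s is (l, v) :: s' then
    (j + nw_length s', v, s' != [::])%N
      :: [seq (j + nw_length s' + (l - p.+1), 0, false)%N | p <- iota 0 l.-1]
      ++ path_ops s' j
  else [::].

Lemma nw_length_ord (s : seq (nat * nat)) :
  nw_length s = (\sum_(i < size s) (nth (0, 0)%N s i).1)%N.
Proof. by rewrite /nw_length (big_nth (0, 0)%N) big_mkord. Qed.

Lemma S_op_cons l v s j : S_op ((l, v) :: s) j =
  op_comp (op_comp (act dy_additive (j + nw_length s, v, s != [::])%N)
    (\big[op_comp/id]_(p < l.-1) dy (j + nw_length s + (l - p.+1)) 0)) (S_op s j).
Proof.
have sum_lift k : (\sum_(i < (size s).+1 | k.+1 <= i) (nth (0, 0) ((l, v) :: s) i).1)%N =
    (\sum_(i < size s | k <= i) (nth (0, 0) s i).1)%N.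
  by rewrite big_mkcond big_ord_recl /= add0n [RHS]big_mkcond.
have sum0 : (\sum_(i < size s | 0 <= i) (nth (0, 0) s i).1)%N = nw_length s.
  by rewrite nw_length_ord.
have sumT : (\sum_(i < (size s).+1 | 0 <= i) (nth (0, 0) ((l, v) :: s) i).1)%N =
    (l + nw_length s)%N by rewrite big_mkcond big_ord_recl /= nw_length_ord.
have congr_comp f f' g g' : f = f' -> g = g' -> op_comp f g = op_comp f' g'.
  by move=> -> ->.
rewrite [LHS]/S_op; cbv zeta; apply: (etrans (@big_ord_recl _ id op_comp (size s) _)).
apply: (congr_comp); first apply: (congr_comp).
- apply/funext => g; rewrite /act /= sum_lift sum0; by case: (s).
- rewrite /=. apply: eq_bigr => -[p lt_pl] _ /=.
  apply: (congr1 (fun x => dy x 0)).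
  apply: (etrans (congr1 (fun t => j + t - p - 1)%N sumT)).
  by clear -lt_pl; lia.
- rewrite /S_op; apply: eq_bigr => k _ /=; apply: congr_comp.
    by apply/funext => g; rewrite /bump /= add1n sum_lift.
  by apply: eq_bigr => p _; rewrite /bump /= add1n sum_lift.
Qed.

Lemma run_cat os1 os2 g :
  run dy_additive (os1 ++ os2) g = run dy_additive os1 (run dy_additive os2 g).
Proof. exact: foldr_cat. Qed.

Lemma run_dy0 (T : Type) (r : seq T) (F : T -> nat) g :
  run dy_additive [seq (F p, 0, false)%N | p <- r] g = foldr (fun p => dy (F p) 0) g r.
Proof. by elim: r => //= p r ->; rewrite /act /= mulr0n subr0. Qed.

Lemma S_op_run s j g : S_op s j g = run dy_additive (path_ops s j) g.
Proof.
elim: s j g => [|[l v] s IH] j g; first by rewrite /S_op big_ord0.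
rewrite S_op_cons /op_comp /= IH run_cat; congr (act dy_additive _ _).
by rewrite big_op_comp run_dy0 -val_enum_ord foldr_map enumT.
Qed.

(** * The factors of the partition function *)

(** The product of the [y_{0,k}] is treated as the factor of index [0]: it is the
monomial of an infinite multiplicity. *)
Definition factor (D x : nat) : ypoly :=
  if x == 0%N then \prod_(1 <= k < D.+1) yvar 0 k else
  yvar x 0
  + \sum_(1 <= m < D) fpsXn rat (x * m) *: \prod_(1 <= k < m.+1) yvar x k
  + fps_sum [set m | (D <= m)%N]%classic (fun m => fpsXn rat (x * m))
     *: \prod_(1 <= k < D.+1) yvar x k.

Lemma F_truncE D N : F_trunc D N = \prod_(x < N.+1) factor D x.
Proof.
rewrite /F_trunc; apply: esym; apply: (etrans (big_ord_recl _ _)).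
congr (_ * _); rewrite [RHS](big_addn 0 N.+1 1) subn1 big_mkord.
by apply: eq_bigr => i _; rewrite addn1.
Qed.

Lemma fps_coefD (a b : fps rat) n : (a + b) n = a n + b n.
Proof. by []. Qed.
Lemma fps_coefB (a b : fps rat) n : (a - b) n = a n - b n.
Proof. by []. Qed.
Lemma fps_coef0 n : (0 : fps rat) n = 0.
Proof. by rewrite /= if_same. Qed.
Lemma fps_coef_sum (I : Type) (r : seq I) (P : pred I) (F : I -> fps rat) n :
  (\sum_(i <- r | P i) F i) n = \sum_(i <- r | P i) F i n.
Proof. by apply: (big_morph (fun a : fps rat => a n)) => //; exact: fps_coef0. Qed.
Lemma fps_coefMb (a : fps rat) (b : bool) n : (a * b%:R) n = a n * b%:R.
Proof. by case: b; rewrite ?mulr1 ?mulr0 ?fps_coef0. Qed.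

Section LivesIn.
Variable x : nat.
Let lives := lives_in dy_additive x.

Lemma lives_yvar k : lives (yvar x k).
Proof.
move=> x' h ne; apply: (etrans (dyU _ _ _ _)).
by rewrite ucmE xpair_eqE eq_sym (negPf ne) /= mulr0n; exact: monalgU0.
Qed.

Lemma livesD f g : lives f -> lives g -> lives (f + g).
Proof. by move=> f0 g0 x' h ne; rewrite raddfD f0// g0// addr0. Qed.

Lemma livesZ c g : lives g -> lives (c *: g).
Proof. by move=> g0 x' h ne; apply: (etrans (dyZ _ _ _ _));
apply: (etrans (congr1 (fun a => c *: a) (g0 x' h ne))); exact: scaler0. Qed.

Lemma lives_sum (r : seq nat) (F : nat -> ypoly) :
  (forall i, lives (F i)) -> lives (\sum_(i <- r) F i).
Proof. by move=> F0 x' h ne; rewrite raddf_sum big1// => i _; exact: F0. Qed.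

Lemma lives_prod (r : seq nat) : lives (\prod_(k <- r) yvar x k).
Proof.
move=> x' h ne; elim: r => [|k r IH].
  rewrite big_nil; apply: (etrans (dyU _ _ _ _)).
  by rewrite cm1 mulr0n; exact: monalgU0.
rewrite big_cons; apply: (etrans (dyM _ _ _ _)).
apply: (etrans (congr2 (fun a b => a * _ + _ * b) (lives_yvar k h ne) IH)).
by rewrite mulr0 mul0r addr0.
Qed.

Lemma eval_at1_dy_prod w (r : seq nat) :
  eval_at1 (dy x w (\prod_(k <- r) yvar x k)) = (count_mem w r)%:R.
Proof.
elim: r => [|k r IH].
  rewrite big_nil; apply: (etrans (congr1 eval_at1 (dyU _ _ _ _))).
  by rewrite cm1 mulr0n monalgU0; exact: rmorph0.
rewrite big_cons; apply: (etrans (congr1 eval_at1 (dyM _ _ _ _))).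
apply: (etrans (rmorphD eval_at1 _ _)).
have E1 : eval_at1 (\prod_(j <- r) yvar x j) = 1.
  by rewrite rmorph_prod big1// => i _; exact: eval_at1_yvar.
apply: (etrans (congr2 +%R (rmorphM eval_at1 _ _) (rmorphM eval_at1 _ _))).
apply: (etrans (congr2 (fun a b => a * _ + _ * b) (eval_at1_dy_yvar _ _ _ _) IH)).
apply: (etrans (congr2 (fun a b => _ * a + b * _) E1 (eval_at1_yvar _ _))).
by rewrite mulr1 mul1r xpair_eqE eqxx /= eq_sym -natrD.
Qed.
End LivesIn.

Lemma lives_in_factor D x : lives_in dy_additive x (factor D x).
Proof.
rewrite /factor; case: eqP => [->|_]; first exact: lives_prod.
apply: livesD; last by apply: livesZ; exact: lives_prod.
apply: livesD; first exact: lives_yvar.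
by apply: lives_sum => i; apply: livesZ; exact: lives_prod.
Qed.

(** The series [\sum_m q^(x * m)] over the [m] such that [P m]. *)
Definition multiples (x : nat) (P : pred nat) : fps rat :=
  Fps (fun n => ((x %| n)%N && P (n %/ x)%N)%:R).

Lemma fps_sum_multiples_ge x D n : (0 < x)%N ->
  fps_sum [set m | (D <= m)%N]%classic (fun m => fpsXn rat (x * m)) n =
    multiples x (leq D) n.
Proof.
move=> x_gt0 /=; have [/dvdnP[q ->]|ndiv] /= := boolP (x %| n)%N; last first.
  rewrite fsbig1// => m _; case: eqP => // E; move: ndiv; rewrite E dvdn_mulr//.
rewrite mulnK//; have [Dq|Dq] := leqP D q.
  rewrite (@fsbigE _ _ _ _ _ [:: q])//=.
  - by rewrite big_cons big_nil mem_set //= addr0 mulnC eqxx.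
  - by move=> m; rewrite /= inE => /eqP ->.
  - by move=> m _; rewrite inE mulnC eqn_pmul2l// eq_sym => /negPf ->.
rewrite fsbig1// => m /= Dm; case: eqP => // /eqP; rewrite mulnC eqn_pmul2l// => /eqP E.
by move: Dq; rewrite E ltnNge Dm.
Qed.

(** The multiplicities kept by the derivative of second index [w]. *)
Definition allowed_ge (w m : nat) : bool := if w == 0%N then m == 0%N else (w <= m)%N.

(** The multiplicities kept by [act] for the run length [o.1] and the flag [o.2]. *)
Definition allowed (o : nat * bool) (m : nat) : bool :=
  if o.1 == 0%N then m == 0%N else if o.2 then m == o.1 else (o.1 <= m)%N.

(** All the multiplicities [m >= D] carry the same monomial, whence [minn m D]. *)
Lemma factor_series D x (b : bool) (P : pred nat) : (0 < D)%N -> (0 < x)%N ->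
  b%:R + \sum_(1 <= m < D) fpsXn rat (x * m) * (P m)%:R
    + fps_sum [set m | (D <= m)%N]%classic (fun m => fpsXn rat (x * m)) * (P D)%:R
  = multiples x (fun m => if m == 0%N then b else P (minn m D)).
Proof.
move=> D_gt0 x_gt0; apply: fpsP => n; rewrite !fps_coefD.
rewrite fps_coef_sum fps_coefMb fps_sum_multiples_ge//.
have -> : (b%:R : fps rat) n = ((n == 0%N) && b)%:R.
  by case: b; rewrite ?andbT ?andbF ?fps_coef0 //=; case: (n == 0%N).
under eq_bigr => m _ do rewrite fps_coefMb.
rewrite /=.
have [/dvdnP[q ->]|ndiv] /= := boolP (x %| n)%N; last first.
  rewrite mul0r big1 => [|m _]; last first.
    case: eqP => [E|_]; last by rewrite mul0r.
    by move: ndiv; rewrite E dvdn_mulr.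
  by case: eqP ndiv => [->|]; rewrite ?dvdn0 ?addr0.
rewrite mulnK// muln_eq0 (gtn_eqF x_gt0) orbF.
have -> : \sum_(1 <= m < D) (q * x == x * m)%N%:R * (P m)%:R =
   ((1 <= q < D) && P q)%N%:R :> rat.
  have eqE m : (q * x == x * m)%N = (m == q) by rewrite mulnC eqn_pmul2l// eq_sym.
  under eq_bigr => m _ do rewrite eqE.
  have [qD|qD] := boolP (q \in index_iota 1 D); last first.
    rewrite -mem_index_iota (negPf qD) big_seq big1// => m mD.
    by case: eqP => [E|]; rewrite ?mul0r//; move: qD; rewrite -E mD.
  rewrite (bigD1_seq q) ?iota_uniq//= eqxx mul1r big1 ?addr0 => [|m /negPf ->].
    by rewrite -mem_index_iota qD.
  by rewrite mul0r.
have [->|q_gt0] := posnP q; first by rewrite leqn0 (gtn_eqF D_gt0) mul0r !addr0.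
rewrite add0r; have [Dq|qD] := leqP D q.
  by rewrite add0r mul1r.
by rewrite mul0r addr0.
Qed.

(** For [w > 0], the monomial of multiplicity [m], which is the product of the
[y_{x,k}] with [0 < k <= min m D], contains [y_{x,w}] exactly when [w <= m],
because [w <= D]. *)
Lemma eval_at1_dy_factor D x w : (0 < D)%N -> (0 < x)%N -> (w <= D)%N ->
  eval_at1 (dy_additive x w (factor D x)) = multiples x (allowed_ge w).
Proof.
move=> D_gt0 x_gt0 wD.
have cnt m : count_mem w (index_iota 1 m.+1) = ((0 < w) && (w <= m))%N :> nat.
  by rewrite count_uniq_mem ?iota_uniq// mem_index_iota.
have -> : eval_at1 (dy_additive x w (factor D x)) = (w == 0%N)%:R +
    \sum_(1 <= m < D) fpsXn rat (x * m) * ((0 < w) && (w <= m))%N%:R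
    + fps_sum [set m | (D <= m)%N]%classic (fun m => fpsXn rat (x * m))
      * ((0 < w) && (w <= D))%N%:R.
  rewrite /factor gtn_eqF// !raddfD; congr (_ + _ + _).
  - by apply: (etrans (eval_at1_dy_yvar _ _ _ _)); rewrite xpair_eqE eqxx eq_sym.
  - rewrite (raddf_sum (dy_additive x w)) (raddf_sum eval_at1); apply: eq_bigr => m _.
    apply: (etrans (congr1 eval_at1 (dyZ _ _ _ _))); apply: (etrans (eval_at1Z _ _)).
    by congr (_ * _); apply: (etrans (eval_at1_dy_prod _ _ _)); rewrite cnt.
  - apply: (etrans (congr1 eval_at1 (dyZ _ _ _ _))); apply: (etrans (eval_at1Z _ _)).
    by congr (_ * _); apply: (etrans (eval_at1_dy_prod _ _ _)); rewrite cnt.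
rewrite (factor_series _ (fun m => (0 < w) && (w <= m))%N)//.
apply: fpsP => n /=; case: (x %| n)%N => //=; rewrite /allowed_ge.
move: (n %/ x)%N => q; congr (nat_of_bool _)%:R.
have [->|w_gt0] := posnP w; first by case: q.
by case: q => [|q] /=; [rewrite leqn0 gtn_eqF | rewrite leq_min wD andbT].
Qed.

Lemma eval_at1_act_factor D x w (b : bool) :
  (0 < x)%N -> (w + b <= D)%N -> (0 < D)%N -> (0 < w)%N || ~~ b ->
  eval_at1 (act dy_additive (x, w, b) (factor D x)) = multiples x (allowed (w, b)).
Proof.
move=> x_gt0 wbD D_gt0 wb; have -> : eval_at1 (act dy_additive (x, w, b) (factor D x)) =
    eval_at1 (dy_additive x w (factor D x)) - eval_at1 (dy_additive x w.+1 (factor D x)) *+ b.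
  by rewrite /act raddfB raddfMn.
have E1 : eval_at1 (dy_additive x w (factor D x)) = multiples x (allowed_ge w).
  by apply: eval_at1_dy_factor => //; exact: leq_trans (leq_addr _ _) wbD.
apply: (etrans (congr1 (fun a => a - _) E1)).
case: b wbD wb => wbD wb; last first.
  by rewrite mulr0n subr0; apply: fpsP => n /=; rewrite /allowed /allowed_ge.
have E2 : eval_at1 (dy_additive x w.+1 (factor D x)) = multiples x (allowed_ge w.+1).
  by apply: eval_at1_dy_factor => //; rewrite -addn1.
apply: (etrans (congr1 (fun a => _ - a *+ true) E2)); rewrite mulr1n.
rewrite orbF in wb; apply: fpsP => n; rewrite fps_coefB /= /allowed /allowed_ge /= (gtn_eqF wb).
case: (x %| n)%N => //=; rewrite ?subrr//.
rewrite eq_sym leq_eqVlt; case: eqP => [->|_] /=; first by rewrite ltnn subr0.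
by rewrite subrr.
Qed.

Lemma eval_at1_factor0 D : eval_at1 (factor D 0) = 1.
Proof. by rewrite /factor rmorph_prod big1// => i _; exact: eval_at1_yvar. Qed.

(** The multiplicity of [0] being infinite, it satisfies every lower bound. *)
Lemma eval_at1_act_factor0 D w : (0 < w <= D)%N ->
  eval_at1 (act dy_additive (0, w, false)%N (factor D 0)) = 1.
Proof.
move=> wD; rewrite /act /= mulr0n subr0; apply: (etrans (eval_at1_dy_prod _ _ _)).
by rewrite count_uniq_mem ?iota_uniq// mem_index_iota ltnS wD.
Qed.

Lemma eval_at1_factor D x : (0 < D)%N -> (0 < x)%N -> eval_at1 (factor D x) = multiples x predT.
Proof.
move=> D_gt0 x_gt0.
have evp r : eval_at1 (\prod_(k <- r) yvar x k) = 1.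
  by rewrite rmorph_prod big1// => i _; exact: eval_at1_yvar.
transitivity ((true%:R : fps rat) + \sum_(1 <= m < D) fpsXn rat (x * m) * (predT m)%:R +
    fps_sum [set m | (D <= m)%N]%classic (fun m => fpsXn rat (x * m)) * (predT D)%:R).
  rewrite /factor gtn_eqF// !(raddfD eval_at1); congr (_ + _ + _).
  - exact: eval_at1_yvar.
  - rewrite (raddf_sum eval_at1); apply: eq_bigr => m _; apply: (etrans (eval_at1Z _ _)).
    by rewrite evp.
  - by apply: (etrans (eval_at1Z _ _)); rewrite evp.
by rewrite (factor_series _ predT)//; apply: fpsP => n /=; rewrite if_same.
Qed.

(** * Coefficients of the evaluated products *)

(** The operators to which the local computations apply: the second indices are at
most [D], an exact run is not empty, and only a lower bound may be imposed at
abscissa [0]. *)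
Definition valid_op (D : nat) (o : nat * nat * bool) : bool :=
  [&& o.1.2 + o.2 <= D, (0 < o.1.2) || ~~ o.2 & (o.1.1 == 0) ==> ((0 < o.1.2) && ~~ o.2)]%N.

Definition ops_allow (os : seq (nat * nat * bool)) (x m : nat) : bool :=
  all (fun o => (o.1.1 == x) ==> allowed (o.1.2, o.2) m) os.

Lemma eq_multiples x P Q : P =1 Q -> multiples x P = multiples x Q.
Proof. by move=> PQ; apply: fpsP => n /=; rewrite PQ. Qed.

Lemma eval1_run D N os : (0 < D)%N -> all (valid_op D) os ->
  uniq [seq o.1.1 | o <- os] -> all (fun o => o.1.1 <= N)%N os ->
  eval1 (run dy_additive os (F_trunc D N)) = \prod_(x < N) multiples x.+1 (ops_allow os x.+1).
Proof.
move=> D_gt0 /allP osD os_uniq osN; rewrite eval1E F_truncE.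
pose G x := if x == 0%N then 1 else multiples x (ops_allow os x).
have dC x h x' h' g : x != x' ->
    dy_additive x h (dy_additive x' h' g) = dy_additive x' h' (dy_additive x h g).
  exact: dyC.
rewrite (@run_prod _ _ _ eval_at1 dyM dC os _ _ G) //.
- by rewrite big_ord_recl mul1r.
- exact: lives_in_factor.
- move=> [[x w] b] os_o; have /and3P[/= wD wb x0] := osD _ os_o; rewrite /G /=.
  have [x_0|x_gt0] := posnP x.
    have /andP[w_gt0 /negPf b0] : ((0 < w) && ~~ b)%N by move: x0; rewrite x_0.
    subst x b; rewrite eval_at1_act_factor0// w_gt0.
    by rewrite addn0 in wD.
  rewrite eval_at1_act_factor//; apply: eq_multiples => m.
  apply/idP/allP => [ok [[x' w'] b'] os_o'|/(_ _ os_o)]; last by rewrite /= eqxx.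
  apply/implyP => /= /eqP E.
  have [i lti Ei] := nthP (0, 0, false)%N os_o; have [i' lti' Ei'] := nthP (0, 0, false)%N os_o'.
  suff E2 : i = i' by move: Ei'; rewrite -E2 Ei => -[_ <- <-].
  apply/eqP; rewrite -(@nth_uniq _ 0%N _ i i' _ _ os_uniq) ?size_map//.
  by rewrite !(nth_map (0, 0, false)%N)// Ei Ei' /= E.
- move=> x _ xos; rewrite /G; have [->|x_gt0] := posnP x; first exact: eval_at1_factor0.
  rewrite eval_at1_factor//; apply: eq_multiples => m.
  apply/esym/allP => o os_o; apply/implyP => /eqP E.
  by move: xos; rewrite -E (map_f (fun o => o.1.1) os_o).
Qed.

Lemma fpsXnM a b : fpsXn rat a * fpsXn rat b = fpsXn rat (a + b).
Proof.
apply: fpsP => n /=; case: (leqP a n) => [an|na].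
  rewrite (bigD1 (inord a))//= inordK ?ltnS// eqxx mul1r big1 ?addr0 => [|i /eqP ia].
    by rewrite -(eqn_add2l a) subnKC.
  by case: eqP => [E|]; rewrite ?mul0r//; case: ia; apply: val_inj; rewrite /= inordK.
rewrite big1 => [|i _].
  by case: eqP => // E; move: na; rewrite E ltnNge leq_addr.
by case: eqP => [E|]; rewrite ?mul0r//; have := ltn_ord i; rewrite E ltnS leqNgt na.
Qed.

Lemma fpsXn0 : fpsXn rat 0 = 1.
Proof. by apply: fpsP => -[|n]. Qed.

Lemma prod_fpsXn (I : finType) (a : I -> nat) (p : pred I) :
  \prod_i (fpsXn rat (a i) * (p i)%:R) = fpsXn rat (\sum_i a i) * [forall i, p i]%:R.
Proof.
rewrite big_split /= -(big_morph (fpsXn rat) (fun x y => esym (fpsXnM x y)) fpsXn0).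
congr (_ * _); case: forallP => [pT|/existsNP[i /negP pi]].
  by rewrite big1// => i _; rewrite pT.
by rewrite (bigD1 i)//= (negPf pi) mul0r.
Qed.

Definition eqmod (n : nat) (a b : fps rat) := forall k, (k <= n)%N -> a k = b k.

Lemma eqmod_prod n (I : Type) (r : seq I) (F G : I -> fps rat) :
  (forall i, eqmod n (F i) (G i)) -> eqmod n (\prod_(i <- r) F i) (\prod_(i <- r) G i).
Proof.
move=> FG; elim/big_rec2: _ => // i a b _ ab k kn /=; apply: eq_bigr => j _.
by rewrite FG ?ab// (leq_trans _ kn) ?leq_subr// -ltnS.
Qed.

(** A multiple [x * m <= n] of [x > 0] has [m <= n]. *)
Lemma multiples_trunc n x P : (0 < x)%N ->
  eqmod n (multiples x P) (\sum_(m < n.+1) fpsXn rat (x * m) * (P m)%:R).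
Proof.
move=> x_gt0 k kn; rewrite fps_coef_sum; under eq_bigr => m _ do rewrite fps_coefMb.
rewrite /=; have [/dvdnP[q E]|ndiv] /= := boolP (x %| k)%N; last first.
  rewrite big1// => m _; case: eqP => [E|]; rewrite ?mul0r//.
  by move: ndiv; rewrite E dvdn_mulr.
have qn : (q < n.+1)%N by rewrite ltnS (leq_trans _ kn)// E leq_pmulr.
rewrite E mulnK// (bigD1 (Ordinal qn))//= mulnC eqxx mul1r big1 ?addr0// => i.
by rewrite -val_eqE /= eqn_pmul2l// eq_sym => /negPf ->; rewrite mul0r.
Qed.

Lemma coef_prod_multiples n N (P : nat -> pred nat) :
  (\prod_(x < N) multiples x.+1 (P x.+1)) n =
  #|[pred m : {ffun 'I_N -> 'I_n.+1} | (\sum_(x < N) x.+1 * m x == n)%N &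
      [forall x : 'I_N, P x.+1 (m x)]]|%:R.
Proof.
rewrite (eqmod_prod _ (fun x : 'I_N => @multiples_trunc n x.+1 (P x.+1) (ltn0Sn x)) (leqnn n)).
rewrite bigA_distr_bigA /= fps_coef_sum -sum1_card natr_sum [RHS]big_mkcond /=.
apply: eq_bigr => m _.
rewrite (@prod_fpsXn _ (fun i : 'I_N => i.+1 * m i)%N (fun i => P i.+1 (m i))) fps_coefMb /=.
by rewrite inE eq_sym; case: eqP; case: [forall _, _] => //=; rewrite ?mul1r ?mulr0 ?mul0r.
Qed.

Definition tuple_ops (l : diagram) (j : {ffun components l -> nat}) :=
  flatten [seq path_ops (nw_path (val c)) (j c) | c <- index_enum (components l)].

Lemma S_tuple_run (l : diagram) (j : {ffun components l -> nat}) g :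
  S_tuple j g = run dy_additive (tuple_ops j) g.
Proof.
rewrite /S_tuple big_op_comp /tuple_ops; elim: (index_enum _) => //= c r ->.
by rewrite S_op_run run_cat.
Qed.

Local Close Scope ring_scope.
Local Open Scope nat_scope.

(** * From operators to Ferrers diagrams *)

(** The operators of [path_ops] from west to east, read on the profile. *)
Definition profile_ops (j : nat) (w : seq nat) : seq (nat * nat * bool) :=
  [seq (j + i, nth 0 w i, (0 < i) && (0 < nth 0 w i)) | i <- iota 0 (size w)].

Lemma perm_rev_iota m k : perm_eq [seq m + (k - p) | p <- iota 0 k] (iota m.+1 k).
Proof.
apply: uniq_perm; rewrite ?iota_uniq//.
  by rewrite map_inj_in_uniq ?iota_uniq// => x y; rewrite !mem_iota; lia.
move=> x; rewrite mem_iota; apply/mapP/idP => [[p + ->]|xk]; first by rewrite mem_iota; lia.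
by exists (k - (x - m)); rewrite ?mem_iota; lia.
Qed.

(** Only the order differs; the run of rank [0] is the last one of the path, the
one without upper bound. *)
Lemma path_ops_profile s j : wf_path s -> perm_eq (path_ops s j) (profile_ops j (profile s)).
Proof.
elim: s => [//|[l v] s IH] /andP[/andP[/= l_gt0 v_gt0] wf].
have sz := size_profile wf; have {}IH := IH wf; set w := profile s in sz IH *.
have sE : (s != [::]) = (0 < size w).
  rewrite sz; case: (s) wf => [|[l' v'] s']; first by rewrite /nw_length big_nil.
  by move=> /andP[/andP[/= l'0 _] _]; rewrite /nw_length big_cons /= addn_gt0 l'0.
rewrite /profile_ops size_cat /= size_nseq iotaD map_cat /= add0n.
have -> : [seq (j + i, nth 0 (w ++ v :: nseq l.-1 0) i,
     (0 < i) && (0 < nth 0 (w ++ v :: nseq l.-1 0) i)) | i <- iota 0 (size w)] = profile_ops j w.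
  by apply/eq_in_map => i; rewrite mem_iota add0n => /= iw; rewrite nth_cat iw.
rewrite nth_cat ltnn subnn /= v_gt0 andbT sE -sz.
(* The operator of the south run comes first in [path_ops], and right after the
   operators of the rest of the path in the profile. *)
rewrite perm_sym perm_catC perm_sym /= perm_cons perm_cat//.
have zE : [seq (j + i, nth 0 (w ++ v :: nseq l.-1 0) i,
      (0 < i) && (0 < nth 0 (w ++ v :: nseq l.-1 0) i)) | i <- iota (size w).+1 l.-1]
    = [seq (j + i, 0, false) | i <- iota (size w).+1 l.-1].
  apply/eq_in_map => i; rewrite mem_iota => /andP[wi il]; rewrite nth_cat ltnNge (ltnW wi) /=.
  by rewrite (_ : i - size w = (i - (size w).+1).+1) /= ?nth_nseq ?if_same ?ltnn ?andbF//; lia.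
have -> : [seq (j + size w + (l - p.+1), 0, false) | p <- iota 0 l.-1] =
    [seq (j + i, 0, false) | i <- [seq size w + (l.-1 - p) | p <- iota 0 l.-1]].
  by rewrite -map_comp; apply: eq_map => p /=; congr (_, _, _); lia.
by rewrite zE perm_map// perm_rev_iota.
Qed.

Lemma profile_ops_uniq j w : uniq [seq o.1.1 | o <- profile_ops j w].
Proof.
rewrite /profile_ops -map_comp map_inj_uniq ?iota_uniq// => i i' /= /addnI.
exact.
Qed.

Lemma col_gap_lt_card (l : diagram) (x y1 y2 : nat) : convex l ->
  (x, y1) \in l -> (x, y2) \in l -> y2 - y1 < #|` l |.
Proof.
move=> lV p1 p2; have [y12|y21] := leqP y1 y2; last first.
  by rewrite (_ : y2 - y1 = 0) ?cardfs_gt0; [apply/fset0Pn; exists (x, y1) | lia].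
have -> : (y2 - y1).+1 = #|` [fset (x, (y1 + nat_of_ord i)%N) | i : 'I_(y2 - y1)%N.+1]%fset |.
  by rewrite card_imfset /= -?cardE ?card_ord// => i i' [/addnI/val_inj].
apply: fsubset_leq_card; apply/fsubsetP => _ /imfsetP[i _ ->].
by apply: (convex_mem lV p1 p2); have := ltn_ord i; lia.
Qed.

(** An operator of run length [0] asks for the multiplicity [0], just as an exact
run of length [0] would. *)
Lemma allowed_fits mu j w : 0 < nth 0 w 0 -> 0 < size w ->
  (forall x, 0 < x -> ops_allow (profile_ops j w) x (mult mu x)) <-> fits mu j w.
Proof.
move=> w0 w_gt0; split=> [all|[fit fit0] x x_gt0].
  have H i : i < size w -> 0 < j + i ->
      allowed (nth 0 w i, (0 < i) && (0 < nth 0 w i)) (mult mu (j + i)).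
    move=> iw ji; have /allP := all _ ji.
    move=> /(_ (j + i, nth 0 w i, (0 < i) && (0 < nth 0 w i))); rewrite /= eqxx; apply.
    by apply/mapP; exists i; rewrite ?mem_iota.
  split=> [i iw|j_gt0].
    have := H _ iw ltac:(lia); rewrite /allowed /=.
    case: eqP => [->|/eqP ne] /=; first by move/eqP.
    by rewrite lt0n ne => /eqP.
  by have := H 0 w_gt0 ltac:(lia); rewrite addn0 /allowed /= gtn_eqF.
apply/allP => _ /mapP[i + ->]; rewrite mem_iota add0n => /= iw.
apply/implyP => /= /eqP E; subst x; rewrite /allowed /=.
case: i iw x_gt0 => [|i] iw ji.
  by rewrite addn0 gtn_eqF// fit0//; rewrite addn0 in ji.
by rewrite fit//= lt0n; case: (nth 0 w i.+1) => //= k; rewrite eqxx.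
Qed.

Section TupleOps.
Variables (l : diagram) (lV : convex l).
Let w (c : components l) := profile (nw_path (val c)).
Implicit Type j : {ffun components l -> nat}.

Let cP (c : components l) : [/\ convex (val c), connected (val c), wf_path (nw_path (val c)) &
  exists a T, has_profile (val c) a (w c) T].
Proof. exact: component_profile lV (valP c). Qed.

Let tops j := flatten [seq profile_ops (j c) (w c) | c <- index_enum (components l)].

Lemma tuple_ops_perm j : perm_eq (tuple_ops j) (tops j).
Proof.
rewrite /tuple_ops /tops; elim: (index_enum _) => //= c r IH.
by apply: perm_cat => //; have [_ _ wf _] := cP c; exact: path_ops_profile.
Qed.

Lemma mem_tuple_ops j o : (o \in tuple_ops j) = [exists c, o \in profile_ops (j c) (w c)].
Proof.
rewrite (perm_mem (tuple_ops_perm j)).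
by apply/flatten_mapP/existsP => [[c _ oc]|[c oc]]; exists c.
Qed.

Lemma tuple_ops_allow j x m :
  ops_allow (tuple_ops j) x m <-> forall c, ops_allow (profile_ops (j c) (w c)) x m.
Proof.
split=> [/allP H c|H]; apply/allP => o oo.
  by apply: H; rewrite mem_tuple_ops; apply/existsP; exists c.
by move: oo; rewrite mem_tuple_ops => /existsP[c oc]; have /allP := H c; apply.
Qed.

Lemma tuple_ops_fits j mu :
  (forall x, 0 < x -> ops_allow (tuple_ops j) x (mult mu x)) <-> forall c, fits mu (j c) (w c).
Proof.
have H c := cP c; split=> [all c|fit x x_gt0].
  have [_ _ _ [a [T p]]] := H c.
  apply/(allowed_fits _ _ (profile_left p) (profile_size p)) => x x_gt0.
  by have /tuple_ops_allow := all x x_gt0.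
apply/tuple_ops_allow => c; have [_ _ _ [a [T p]]] := H c.
by move: x x_gt0; apply/(allowed_fits _ _ (profile_left p) (profile_size p)).
Qed.

Lemma tuple_ops_uniq j : disjoint_tuples l j -> uniq [seq o.1.1 | o <- tuple_ops j].
Proof.
move=> jd; rewrite (perm_uniq (perm_map _ (tuple_ops_perm j))) map_flatten -map_comp.
have := index_enum_uniq (components l); elim: (index_enum _) => //= c r IH /andP[cr r_uniq].
rewrite cat_uniq IH// profile_ops_uniq andbT /=.
apply/hasPn => x /flatten_mapP[d dr /= /mapP[_ /mapP[i + ->] /= Ex]].
rewrite mem_iota add0n => /= iw; apply/negP => /mapP[_ /mapP[i' + ->] /= Ex'].
rewrite mem_iota add0n => /= iw'.
have cd : c != d by apply: contraNneq cr => ->.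
have := jd c d cd x; rewrite !(interval_ofE lV) -/(w c) -/(w d); move: iw iw' Ex Ex'.
by lia.
Qed.

(** A south run of length [h] between two columns goes along the east column, of
which it leaves out at least the row shared with the west column, so [h + 1] is
at most the number of boxes [D]. The abscissa [0] can only be a west end. *)
Lemma tuple_ops_valid D j : #|` l | = D -> all (valid_op D) (tuple_ops j).
Proof.
move=> lD; apply/allP => o; rewrite mem_tuple_ops => /existsP[c /mapP[i + ->]].
rewrite mem_iota add0n => /= iw; have [_ _ _ [a [T p]]] := cP c.
have [cl _ _] : [/\ {subset val c <= l}, connected (val c) & closed_in l (mem (val c))].
  by apply/componentsP; exact: valP.
rewrite /valid_op /=; apply/and3P; split.
- have [ti _] := profile_top p iw; case: i iw ti => [|i] iw ti.
    have := col_gap_lt_card lV (cl _ _) (cl _ (profile_bot p)); rewrite addn0 in ti.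
    move=> /(_ _ ti); have := profile_left p; rewrite /= lD; lia.
  have := col_gap_lt_card lV (cl _ ti) (cl _ (profile_overlap p iw)).
  rewrite (profile_drop p iw) lD /=.
  rewrite addKn; by case: (nth 0 (w c) i.+1) => [|k]; lia.
- by case: (0 < nth 0 (w c) i); rewrite ?andbF.
- apply/implyP => /eqP ji; have -> : i = 0 by lia.
  by rewrite (profile_left p).
Qed.
End TupleOps.

Lemma fps_lim_coefE (u : nat -> fps rat) n x :
  (exists N0, forall N, N0 <= N -> u N n = x) -> fps_lim_coef u n x /\ fps_lim u n = x.
Proof.
move=> ux; split=> //=; case: xgetP => [y _ [N1 uy]|/(_ x)//].
by have [N0 ux'] := ux; rewrite -(uy (maxn N0 N1)) ?leq_maxr// ux'// leq_maxl.
Qed.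

Section FitSets.
Variables (l : diagram) (lV : convex l).
Let w (c : components l) := profile (nw_path (val c)).
Implicit Type j : {ffun components l -> nat}.

Definition fit_set n j : {fset diagram} :=
  [fset mu in ferrers_of_size n |
    `[< forall c : components l, fits mu (j c) (profile (nw_path (val c))) >]]%fset.

Lemma fit_setP n j mu : reflect (mu \in ferrers_of_size n /\ forall c, fits mu (j c) (w c))
  (mu \in fit_set n j).
Proof.
apply: (iffP idP); rewrite [_ \in fit_set _ _](in_fset_filter (ferrers_of_size n)).
  by move=> /andP[mun /asboolP].
by move=> [mun fit]; rewrite mun; exact/asboolP.
Qed.

(** If [j c > 0] then [mu] has a row of length [j c], as the south run at the west
end is not empty. *)
Lemma fits_left_le n mu j c : mu \in ferrers_of_size n -> fits mu (j c) (w c) -> j c <= n.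
Proof.
move=> /ferrers_of_sizeP[muF mun] [_ fit0]; have [->//|j_gt0] := posnP (j c).
have [_ _ _ [a [T p]]] := component_profile lV (valP c).
have h_gt0 : 0 < height mu (j c).-1.
  have := fit0 j_gt0; rewrite /mult; have := profile_left p; rewrite -/(w c); lia.
have := ferrers_col_lt muF (p := ((j c).-1, 0)); rewrite mem_height// mun => /(_ h_gt0) /=.
by rewrite prednK.
Qed.

Definition bounded_tuples n : {fset {ffun components l -> nat}} :=
  [fset finfun (fun c => nat_of_ord (fun_of_fin m c)) |
    m in {: {ffun components l -> 'I_n.+1}}]%fset.

Lemma mem_bounded_tuples n j : (forall c, j c <= n) -> j \in bounded_tuples n.
Proof.
move=> jn; apply/imfsetP; exists [ffun c => inord (j c)] => //.
by apply/ffunP => c; rewrite !ffunE inordK// ltnS.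
Qed.

(** This is what makes the sum over the tuples [q]-adically summable. *)
Lemma fit_set_bounded n j : fit_set n j != fset0 -> j \in bounded_tuples n.
Proof.
case/fset0Pn => mu /fit_setP[mun fit]; apply: mem_bounded_tuples => c.
exact: fits_left_le mun (fit c).
Qed.

End FitSets.

Section Limit.
Variables (D : nat) (l : diagram).
Hypotheses (D_gt0 : 0 < D) (lV : convex l) (lD : #|` l | = D).
Implicit Type j : {ffun components l -> nat}.

(** No part of a partition of [n] exceeds [n], and no operator acts beyond the
factors in use, so neither sees the truncation at [N]. *)
Lemma S_F_coef j N n : disjoint_tuples l j -> n <= N -> all (fun o => o.1.1 <= N) (tuple_ops j) ->
  S_F D j N n = (#|` fit_set n j |%:R)%R.
Proof.
move=> jd nN cols; rewrite /S_F S_tuple_run eval1_run//; last 2 first.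
- exact: tuple_ops_valid.
- exact: tuple_ops_uniq.
rewrite coef_prod_multiples count_by_mult//; congr (_%:R)%R; congr (size (enum_fset _)).
apply/fsetP => mu; rewrite in_fset_filter; apply/andP/fit_setP => -[mun H]; split=> //.
  apply/(tuple_ops_fits lV) => x x_gt0; have [xN|Nx] := leqP x N.
    have xN' : x.-1 < N by rewrite prednK.
    by move/forallP: H => /(_ (Ordinal xN')); rewrite /= prednK.
  apply/allP => o oo; apply/implyP => /eqP E; have /allP := cols => /(_ _ oo).
  by rewrite /= E leqNgt Nx.
by apply/forallP => x; move/(tuple_ops_fits lV): H; apply.
Qed.

Lemma S_F_lim j n : disjoint_tuples l j -> exists N0, forall N, N0 <= N ->
  S_F D j N n = (#|` fit_set n j |%:R)%R.
Proof.
move=> jd; exists (maxn n (\max_(o <- tuple_ops j) o.1.1)) => N.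
rewrite geq_max => /andP[nN oN]; apply: S_F_coef => //; apply/allP => o oo.
apply: leq_trans oN; exact: (@leq_bigmax_seq _ (tuple_ops j) xpredT (fun o => o.1.1)).
Qed.

Lemma S_F_converges j : disjoint_tuples l j -> fps_converges (S_F D j).
Proof.
by move=> jd n; have [] := fps_lim_coefE (S_F_lim n jd); exists (#|` fit_set n j |%:R)%R.
Qed.

Lemma fps_lim_S_F j n : disjoint_tuples l j -> fps_lim (S_F D j) n = (#|` fit_set n j |%:R)%R.
Proof. by move=> jd; have [] := fps_lim_coefE (S_F_lim n jd). Qed.

Lemma T_F_definedP : T_F_defined D l.
Proof.
split=> [j jd|n]; first exact: S_F_converges.
apply: (@sub_finite_set _ _ [set` bounded_tuples l n]); last exact: finite_fset.
move=> j [jd]; rewrite /mkset fps_lim_S_F// => ne; apply: (fit_set_bounded lV).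
by apply: contraNneq ne => ->; rewrite cardfs0.
Qed.

Lemma T_F_coef n : (T_F D l n = (mult_fact l)%:R^-1 *
  (\sum_(j <- bounded_tuples l n | `[< disjoint_tuples l j >]) #|` fit_set n j |)%N%:R)%R.
Proof.
have coefC (x : rat) (f : fps rat) : ((fpsC x * f)%R n = x * f n)%R.
  rewrite [LHS]/= big_ord_recl /= subn0 big1 ?addr0// => i _.
  by rewrite mul0r.
rewrite /T_F coefC; congr (_ * _)%R.
have TE : {in disjoint_tuples l, (fun j => fps_lim (S_F D j) n) =1
    (fun j => #|` fit_set n j |%:R%R : rat)}.
  by move=> j jd; rewrite fps_lim_S_F// -in_setE.
rewrite /fps_sum [LHS]/= (@eq_fsbigr _ _ _ _ _ _ _ TE).
rewrite (@fsbigE _ _ _ _ _ [seq j <- bounded_tuples l n | `[< disjoint_tuples l j >]]).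
- rewrite natr_sum big_filter_cond; apply: eq_bigl => j.
  by case: asboolP => //= jd; rewrite mem_set.
- by rewrite filter_uniq// fset_uniq.
- by move=> j; rewrite /= mem_filter => /andP[/asboolP].
- move=> j jd; rewrite mem_filter asboolT//= => nb; apply/eqP; rewrite pnatr_eq0 cardfs_eq0.
  by apply: contraNT nb; exact: (fit_set_bounded lV).
Qed.
End Limit.

(** * Counting nested pairs class by class *)

Lemma card_components (l : diagram) : #|` l | = \sum_(c <- components l) #|` c |.
Proof.
transitivity (\sum_(p <- l) \sum_(c <- components l) (p \in c)).
  rewrite card_fset_sum1; apply: eq_big_seq => p pl.
  have [c cC pc] := components_cover pl.
  rewrite (bigD1_seq c)//= pc big_seq_cond big1// => d /andP[dC].
  by case pd: (p \in d) => //; rewrite (components_disj dC cC pd pc) eqxx.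
rewrite exchange_big /=; apply: eq_big_seq => c /componentsP[cl _ _].
have Ec : c = [fset p in l | p \in c]%fset.
  by apply/fsetP => p; rewrite in_fset_filter; case pc: (p \in c); rewrite ?andbF// cl.
rewrite [in RHS]Ec card_fset_sum1 big_fset /= [RHS]big_mkcond; apply: eq_bigr => p _.
by case: (p \in c).
Qed.

Lemma translates_card c d : translates c d -> #|` c | = #|` d |.
Proof.
have embC (m : diagram) : #|` embed m | = #|` m |.
  by rewrite card_imfset//= => -[x y] [x' y'] [-> ->].
by move=> [v cd]; rewrite -(embC d) -cd [RHS]card_imfset ?embC// => a b /addIr.
Qed.

Lemma skew_equiv_card l m : skew_equiv l m -> #|` l | = #|` m |.
Proof.
move=> [f bf ft]; rewrite (card_components l) (card_components m).
rewrite !big_seq_fsetE /= (reindex f) /=; last exact: onW_bij.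
by apply: eq_bigr => c _; exact: translates_card (ft c).
Qed.

Definition adds (l mu mu' : diagram) : bool :=
  (mu `<=` mu')%fset && `[< skew_equiv l (mu' `\` mu)%fset >].

Lemma sum_bool_unique (T : eqType) (s : seq T) (P : pred T) x : uniq s -> x \in s ->
  P x -> (forall y, P y -> y = x) -> \sum_(y <- s) P y = 1.
Proof.
move=> su xs Px Puniq; rewrite (bigD1_seq x)//= Px big1 ?addn0// => y.
by case Py : (P y) => //; rewrite (Puniq _ Py) eqxx.
Qed.

Section DoubleCounting.
Variables (D : nat) (l : diagram).
Hypotheses (lV : convex l) (lD : #|` l | = D).
Implicit Type j : {ffun components l -> nat}.

Lemma places_size j n mu mu' : mu \in ferrers_of_size n -> places j mu mu' ->
  mu' \in ferrers_of_size (n + D).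
Proof.
move=> /ferrers_of_sizeP[muF mun] pl; have [muF' sub _] := pl.
apply/ferrers_of_sizeP; split=> //; have := skew_equiv_card (places_equiv pl).
rewrite lD cardfsD (fsetIidPr sub) mun => ->.
by rewrite subnKC// -mun fsubset_leq_card.
Qed.

(** The enlarged diagram is determined by [j] and [mu]. *)
Lemma sum_places j n mu : mu \in ferrers_of_size n ->
  \sum_(mu' <- ferrers_of_size (n + D)) `[< places j mu mu' >] =
  (`[< disjoint_tuples l j >] && (mu \in fit_set n j) : nat).
Proof.
move=> mun; have /ferrers_of_sizeP[muF _] := mun.
have [/asboolP jd|njd] := boolP `[< disjoint_tuples l j >]; last first.
  rewrite big1// => mu' _; case: asboolP => // pl.
  by have [jd _] := places_fits lV muF pl; rewrite asboolT in njd.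
have [fit|nfit] := boolP (mu \in fit_set n j); last first.
  rewrite big1// => mu' _; case: asboolP => // pl; have [_ fit] := places_fits lV muF pl.
  by move/negP: nfit; case; apply/fit_setP.
have /fit_setP[_ fits] := fit; have [mu' pl] := fits_places lV muF jd fits.
apply: (@sum_bool_unique _ _ _ mu'); first exact: fset_uniq.
- exact: places_size mun pl.
- exact/asboolP.
- by move=> y /asboolP pl'; rewrite (places_unique lV muF pl' pl).
Qed.

Lemma count_places n mu mu' : mu \in ferrers_of_size n -> mu' \in ferrers_of_size (n + D) ->
  \sum_(j <- bounded_tuples l n) `[< places j mu mu' >] = mult_fact l * adds l mu mu'.
Proof.
move=> mun mun'; have /ferrers_of_sizeP[muF _] := mun; have /ferrers_of_sizeP[muF' _] := mun'.
have [/andP[sub /asboolP eqv]|nadd] := boolP (adds l mu mu'); last first.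
  rewrite muln0 big1// => j _; case: asboolP => // pl.
  by move: nadd; rewrite /adds (asboolT (places_equiv pl)) andbT; have [_ ->] := pl.
have [js [js_uniq js_size jsP]] := places_list lV muF muF' sub eqv.
rewrite muln1 -js_size -sum1_size.
have -> : \sum_(j <- bounded_tuples l n) (`[< places j mu mu' >] : nat) =
    \sum_(j <- [seq j <- bounded_tuples l n | `[< places j mu mu' >]]) 1.
  by rewrite big_filter [RHS]big_mkcond; apply: eq_bigr => j _; case: asboolP.
apply: perm_big; apply: uniq_perm => //; first by rewrite filter_uniq// fset_uniq.
move=> j; rewrite mem_filter; apply/andP/idP => [[/asboolP pl _]|/jsP pl]; first exact/jsP.
split; first exact/asboolP; have [_ fit] := places_fits lV muF pl.
suff : j \in bounded_tuples l n by [].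
by apply: (fit_set_bounded lV); apply/fset0Pn; exists mu; exact/fit_setP.
Qed.

(** The triples [(j, mu, mu')] are counted in two ways. *)
Lemma sum_fit_sets n :
  \sum_(j <- bounded_tuples l n | `[< disjoint_tuples l j >]) #|` fit_set n j | =
  mult_fact l *
    \sum_(mu <- ferrers_of_size n) \sum_(mu' <- ferrers_of_size (n + D)) adds l mu mu'.
Proof.
have fitE j : #|` fit_set n j | = \sum_(mu <- ferrers_of_size n) (mu \in fit_set n j).
  have E : fit_set n j = [fset mu in ferrers_of_size n | mu \in fit_set n j]%fset.
    apply/fsetP => mu; rewrite (in_fset_filter (ferrers_of_size n)).
    by apply/idP/andP => [/[dup] /fit_setP[? _] ?|[]].
  rewrite [in LHS]E card_fset_sum1 big_fset /= big_mkcond; apply: eq_bigr => mu _.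
  by case: (mu \in _).
transitivity (\sum_(mu <- ferrers_of_size n) \sum_(j <- bounded_tuples l n)
    (`[< disjoint_tuples l j >] && (mu \in fit_set n j) : nat)).
  rewrite exchange_big /= big_mkcond; apply: eq_bigr => j _; case: asboolP => /= [_|_].
    exact: fitE.
  by rewrite big1.
rewrite big_distrr /=; apply: eq_big_seq => mu mun.
transitivity (\sum_(j <- bounded_tuples l n) \sum_(mu' <- ferrers_of_size (n + D))
    (`[< places j mu mu' >] : nat)).
  by apply: eq_bigr => j _; rewrite sum_places.
rewrite exchange_big big_distrr /=; apply: eq_big_seq => mu' mun'.
exact: count_places.
Qed.
End DoubleCounting.

Lemma mult_fact_gt0 l : convex l -> 0 < mult_fact l.
Proof. by move=> lV; rewrite mult_factE// prodn_gt0// => rho; exact: fact_gt0. Qed.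

Lemma T_F_coef_adds D l n : 0 < D -> convex l -> #|` l | = D ->
  (T_F D l n = (\sum_(mu <- ferrers_of_size n)
    \sum_(mu' <- ferrers_of_size (n + D)) adds l mu mu')%N%:R)%R.
Proof.
move=> D_gt0 lV lD; rewrite T_F_coef// (sum_fit_sets lV lD) natrM mulrA mulVf ?mul1r//.
by rewrite pnatr_eq0 -lt0n mult_fact_gt0.
Qed.

(** * Finiteness of the set of classes *)

(** The values of [f] on [c] have no gap, as [f] grows by at most one between
adjacent boxes. *)
Lemma connected_span (f : nat * nat -> nat) c p q :
  (forall a b, adjacent a b -> f b <= (f a).+1) -> connected c -> p \in c -> q \in c ->
  f q - f p < #|` c |.
Proof.
move=> fadj [_ cC] pc qc; have [pq|qp] := leqP (f p) (f q); last first.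
  by rewrite (_ : f q - f p = 0) ?cardfs_gt0; [apply/fset0Pn; exists p | lia].
have hit k : f p <= k <= f q -> k \in [fset f r | r in c]%fset.
  move=> /andP[pk kq]; apply/negP => nk; have fne r : r \in c -> f r != k.
    by move=> rc; apply/eqP => E; apply: nk; rewrite -E; apply/imfsetP; exists r.
  suff cl : closed_in c (fun r => f r < k).
    have := cC _ cl p q pc qc; rewrite /= [f p < k]ltn_neqAle fne// pk => /(_ isT).
    by rewrite ltnNge kq.
  move=> a b ac bc /fadj fab fak; rewrite ltn_neqAle fne//=; exact: leq_trans fab fak.
have le : #|` [fset f r | r in c]%fset| <= #|` c | by exact: leq_imfset_card.
apply: leq_trans le.
have -> : (f q - f p).+1 = #|` [fset (f p + nat_of_ord i)%N | i : 'I_(f q - f p)%N.+1]%fset |.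
  by rewrite card_imfset /= -?cardE ?card_ord// => i i' /addnI/val_inj.
apply: fsubset_leq_card; apply/fsubsetP => _ /imfsetP[i _ ->]; apply: hit.
by have := ltn_ord i; lia.
Qed.

Definition box (D : nat) : diagram := of_heights D D (fun x => if x < D then D else 0).

Lemma mem_box D (x y : nat) : ((x, y) \in box D) = (x < D) && (y < D).
Proof.
rewrite /box mem_of_heights; first by case: (x < D).
  by move=> z; case: ifP.
by move=> z; rewrite leqNgt => /negPf ->.
Qed.

(** A connected diagram does not span more rows or columns than it has boxes. *)
Lemma translate_into_box D c : connected c -> #|` c | <= D ->
  exists d, translates c d /\ (d `<=` box D)%fset.
Proof.
move=> cC cD; have [[[x0 y0] c0] _] := cC.
have exmin (f : nat * nat -> nat) : exists2 p, p \in c & forall q, q \in c -> f p <= f q.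
  have ex : exists k, has (fun p => f p == k) c.
    by exists (f (x0, y0)); apply/hasP; exists (x0, y0).
  case: (ex_minnP ex) => k /hasP[p pc /eqP <-] kmin; exists p => // q qc.
  by apply: kmin; apply/hasP; exists q.
have [[x1 y1] p1 min1] := exmin fst; have [[x2 y2] p2 min2] := exmin snd.
rewrite /= in min1 min2.
have adj1 a b : adjacent a b -> b.1 <= a.1.+1 by rewrite /adjacent; lia.
have adj2 a b : adjacent a b -> b.2 <= a.2.+1 by rewrite /adjacent; lia.
pose d : diagram := [fset ((p.1 - x1)%N, (p.2 - y2)%N) | p in c]%fset.
exists d; split; last first.
  apply/fsubsetP => _ /imfsetP[p /= pc ->]; rewrite mem_box; apply/andP; split.
    exact: leq_trans (connected_span adj1 cC p1 pc) cD.
  exact: leq_trans (connected_span adj2 cC p2 pc) cD.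
apply/translatesP; exists (- x1%:Z)%R, (- y2%:Z)%R; split.
- move=> x y x' y' Ex Ey; apply/imfsetP/idP => /= [[[x3 y3] /= xy3 [E1 E2]]|xy].
    have := min1 _ xy3; have := min2 _ xy3 => /= ? ?.
    by have [-> ->] : x = x3 /\ y = y3 by lia.
  exists (x, y) => //=; have := min1 _ xy; have := min2 _ xy => /= ? ?.
  by congr pair; lia.
- by move=> x y xy; have := min1 _ xy; have := min2 _ xy => /= ? ?; lia.
- by move=> x y _; lia.
Qed.

Definition normal_form (D : nat) (c : diagram) : diagram :=
  xget fset0 [set d | translates c d /\ (d `<=` box D)%fset]%classic.

Lemma normal_formP D c : connected c -> #|` c | <= D ->
  translates c (normal_form D c) /\ (normal_form D c `<=` box D)%fset.
Proof.
move=> cC cD; rewrite /normal_form; case: xgetP => [d _ //|no].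
by have [d dP] := translate_into_box cC cD; case: (no d).
Qed.

Lemma component_card l c : c \in components l -> #|` c | <= #|` l |.
Proof. by move=> /componentsP[cl _ _]; apply: fsubset_leq_card; apply/fsubsetP. Qed.

Lemma card_components_le l : #|` components l | <= #|` l |.
Proof.
rewrite (card_components l) card_fset_sum1 big_seq [leqRHS]big_seq; apply: leq_sum => c cC.
have /componentsP[_ [[p pc] _] _] := cC.
by rewrite cardfs_gt0; apply/fset0Pn; exists p.
Qed.

Definition class_code (D : nat) (rho : skew_class) : seq diagram :=
  [seq normal_form D c | c <- components (skew_val (repr rho))].

(** Components of the same rank have a common translate, and the components of
rank [i] can be matched with each other. *)
Lemma normal_forms_equiv D l m : #|` l | = D -> #|` m | = D ->
  [seq normal_form D c | c <- components l] = [seq normal_form D d | d <- components m] ->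
  skew_equiv l m.
Proof.
have nf k (c : components k) : #|` k | = D -> translates (val c) (normal_form D (val c)).
  move=> kD; have /componentsP[_ con _] := valP c.
  by have [] := @normal_formP D (val c) con; rewrite // -kD component_card ?(valP c).
move=> lD mD E0.
pose s := enum {: components l}; pose t := enum {: components m}.
have E : [seq normal_form D (val c) | c <- s] = [seq normal_form D (val d) | d <- t].
  by rewrite !(map_comp (normal_form D) val) -!enum_fsetE.
have st : size s = size t by have := congr1 size E; rewrite !size_map.
have mems (c : components l) : c \in s by rewrite mem_enum.
have memt (d : components m) : d \in t by rewrite mem_enum.
have tr i c d : i < size s -> translates (val (nth c s i)) (val (nth d t i)).
  move=> is_; have := congr1 (fun u => nth fset0 u i) E.
  rewrite (nth_map c)// (nth_map d) -?st//= => Ei.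
  apply: translates_trans (nf _ _ lD) _; rewrite Ei; exact: translates_sym (nf _ _ mD).
have ex_t (c : components l) : exists d : components m, true.
  have : 0 < size t by rewrite -st (leq_ltn_trans _ (_ : index c s < size s))// index_mem.
  by case: (t) => // d _; exists d.
have ex_s (d : components m) : exists c : components l, true.
  have : 0 < size s by rewrite st (leq_ltn_trans _ (_ : index d t < size t))// index_mem.
  by case: (s) => // c _; exists c.
pose f c := nth (xchoose (ex_t c)) t (index c s).
pose g d := nth (xchoose (ex_s d)) s (index d t).
have cs c : index c s < size s by rewrite index_mem.
have dt d : index d t < size t by rewrite index_mem.
exists f; first exists g.
- move=> c; rewrite /g /f index_uniq ?enum_uniq -?st//.
  by rewrite (set_nth_default c) ?nth_index.
- move=> d; rewrite /g /f index_uniq ?enum_uniq ?st//.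
  by rewrite (set_nth_default d) ?nth_index.
- by move=> c; rewrite -{1}(nth_index c (mems c)); exact: tr.
Qed.

Lemma card_repr_kind d : Defs.is_skew d -> #|` skew_val (repr (kind d)) | = #|` d |.
Proof.
move=> dS; apply/esym/skew_equiv_card/asboolP; rewrite -kind_eqE//.
Qed.

Lemma skew_repr_convex (rho : skew_diagram) : convex (skew_val rho).
Proof. by apply: skew_convex; case: rho => m /= /asboolP. Qed.

Lemma class_code_inj D rho rho' : skew_classes D rho -> skew_classes D rho' ->
  class_code D rho = class_code D rho' -> rho = rho'.
Proof.
rewrite /skew_classes /= => lD mD E; rewrite -[rho]reprK -[rho']reprK.
by apply/eqmodP/asboolP; exact: normal_forms_equiv lD mD E.
Qed.

(** A class is encoded by the subsets of a box of side [D] that are translates of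
its components. There are at most [D] of them, so the sequence fits in a function
on ['I_D], padded with the empty set, which is not a component. *)
Lemma finite_skew_classes D : finite_set (skew_classes D).
Proof.
pose X := fpowerset (box D).
have X0 : fset0 \in X by rewrite fpowersetE fsub0set.
pose code rho : {ffun 'I_D -> X} :=
  [ffun i : 'I_D => insubd [` X0]%fset (nth fset0 (class_code D rho) i)].
have nth_box rho i : skew_classes D rho -> nth fset0 (class_code D rho) i \in X.
  move=> rD; have [ir|ri] := ltnP i (size (class_code D rho)); last by rewrite nth_default.
  have /mapP[c cC ->] := mem_nth fset0 ir; have /componentsP[_ con _] := cC.
  rewrite fpowersetE; have [] := @normal_formP D c con; rewrite -?rD ?component_card//.
have size_le rho : skew_classes D rho -> size (class_code D rho) <= D.
  by move=> rD; rewrite size_map -[leqRHS]rD card_components_le.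
have nonempty rho i : skew_classes D rho -> i < size (class_code D rho) ->
    nth fset0 (class_code D rho) i != fset0.
  move=> rD ir; have /mapP[c cC ->] := mem_nth fset0 ir.
  have /componentsP[_ con _] := cC; have [[p pc] _] := con.
  rewrite -cardfs_gt0 -(translates_card (_ : translates c _)).
    by rewrite cardfs_gt0; apply/fset0Pn; exists p.
  by have [] := @normal_formP D c con; rewrite -?rD ?component_card.
have code_inj rho rho' : skew_classes D rho -> skew_classes D rho' -> code rho = code rho' ->
    rho = rho'.
  move=> rD rD' E; apply: (class_code_inj rD rD').
  have Enth i : nth fset0 (class_code D rho) i = nth fset0 (class_code D rho') i.
    have [iD|Di] := ltnP i D; last by rewrite !nth_default// (leq_trans (size_le _ _)).
    have := congr1 (fun m : {ffun 'I_D -> X} => val (m (Ordinal iD))) E.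
    by rewrite !ffunE !insubdK//; exact: nth_box.
  have le r r' : skew_classes D r -> (forall i, nth fset0 (class_code D r) i =
      nth fset0 (class_code D r') i) -> size (class_code D r) <= size (class_code D r').
    move=> rr En; rewrite leqNgt; apply/negP => lt; have := nonempty _ _ rr lt.
    by rewrite En nth_default ?eqxx.
  apply: (@eq_from_nth _ fset0) => //; apply/eqP; rewrite eqn_leq le//=.
  by apply: le => // i; rewrite Enth.
(* A partial inverse of [code], whose image contains all the classes. *)
pose g (b : {ffun 'I_D -> X}) :=
  xget (kind fset0) [set rho | skew_classes D rho /\ code rho = b]%classic.
apply: (@sub_finite_set _ _ (g @` setT)%classic); last exact/finite_image/finite_finset.
move=> rho rD; exists (code rho) => //; rewrite /g; case: xgetP => [r -> [rr E]|/(_ rho) no].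
  exact: code_inj.
by case: no.
Qed.

(** * The generating series *)

Lemma euler_char_nestedE n D : euler_char_nested n D =
  \sum_(mu <- ferrers_of_size n) \sum_(mu' <- ferrers_of_size (n + D)) ((mu `<=` mu')%fset : nat).
Proof.
pose A := enum_fset (ferrers_of_size n); pose B := enum_fset (ferrers_of_size (n + D)).
pose s := [seq p <- [seq (mu, mu') | mu <- A, mu' <- B] | (p.1 `<=` p.2)%fset].
have mem_s p : p \in s <-> nested_pairs n (n + D) p.
  rewrite mem_filter /nested_pairs /=.
  split=> [/andP[sub /allpairsP[[mu mu'] [/= Amu Bmu E]]]|[F1 F2 sub E1 E2]].
    subst p; have /ferrers_of_sizeP[? ?] : mu \in ferrers_of_size n := Amu.
    by have /ferrers_of_sizeP[? ?] : mu' \in ferrers_of_size (n + D) := Bmu; split.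
  rewrite sub /=; apply/allpairsP; exists p; case: p F1 F2 sub E1 E2 => mu mu' /= *.
  by split=> //; apply/ferrers_of_sizeP.
have s_uniq : uniq s.
  by apply/filter_uniq/allpairs_uniq; rewrite ?fset_uniq// => -[? ?] [? ?].
have fin : finite_set (nested_pairs n (n + D)).
  by apply: sub_finite_set (finite_seq s) => p /mem_s.
rewrite /euler_char_nested; have -> : #|` fset_set (nested_pairs n (n + D)) | = size s.
  apply: perm_size; apply: uniq_perm => // p; rewrite in_fset_set//.
  by apply/idP/idP => [/set_mem/mem_s|/mem_s/mem_set].
rewrite size_filter -sum1_count big_mkcond big_allpairs; apply: eq_bigr => mu _.
by apply: eq_bigr => mu' _ /=; case: (mu `<=` mu')%fset.
Qed.

(** A nested pair belongs to the class of its difference and to no other. *)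
Lemma sum_classes_adds n D mu mu' : mu \in ferrers_of_size n -> mu' \in ferrers_of_size (n + D) ->
  \sum_(rho <- fset_set (skew_classes D)) (adds (skew_val (repr rho)) mu mu' : nat) =
  (mu `<=` mu')%fset.
Proof.
move=> /ferrers_of_sizeP[muF mun] /ferrers_of_sizeP[muF' mun'].
have [sub|nsub] := boolP (mu `<=` mu')%fset; last first.
  by rewrite big1// => rho _; rewrite /adds (negPf nsub).
have dS : Defs.is_skew (mu' `\` mu)%fset by exists mu, mu'.
have dD : #|` (mu' `\` mu)%fset | = D by rewrite cardfsD (fsetIidPr sub) mun mun' addKn.
have addsE (rho : skew_class) :
    adds (skew_val (repr rho)) mu mu' = (kind (mu' `\` mu)%fset == rho).
  rewrite /adds sub /= kind_eqE//; apply/asboolP/asboolP; exact: skew_equiv_sym.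
apply: (@sum_bool_unique _ _ _ (kind (mu' `\` mu)%fset)); first exact: fset_uniq.
- have : kind (mu' `\` mu)%fset \in fset_set (skew_classes D); last by [].
  rewrite in_fset_set ?mem_set//; last exact: finite_skew_classes.
  by rewrite /skew_classes /= card_repr_kind.
- by rewrite addsE.
- by move=> rho; rewrite addsE => /eqP.
Qed.

Local Open Scope ring_scope.

Theorem corollary7p12 (D : nat) (D_gt0 : (0 < D)%N) :
  (forall l : skew_diagram, #|` skew_val l | = D -> T_F_defined D l) /\
  FZ D = \sum_(rho \in skew_classes D) T_F D (skew_val (repr rho)).
Proof.
split=> [l lD|]; first exact: (T_F_definedP D_gt0 (@skew_repr_convex l) lD).
apply: fpsP => n; rewrite fsbig_finite; last exact: finite_skew_classes.
rewrite fps_coef_sum /= euler_char_nestedE.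
rewrite (eq_big_seq (fun rho => (\sum_(mu <- ferrers_of_size n)
    \sum_(mu' <- ferrers_of_size (n + D)) adds (skew_val (repr rho)) mu mu')%N%:R)%R); last first.
  move=> rho; rewrite in_fset_set; last exact: finite_skew_classes.
  by move=> /set_mem rD; apply: T_F_coef_adds => //; exact: skew_repr_convex.
rewrite -natr_sum; congr (_%:R)%R; rewrite [RHS]exchange_big /=; apply: eq_big_seq => mu mun.
rewrite [RHS]exchange_big /=; apply: eq_big_seq => mu' mun'.
by rewrite (sum_classes_adds mun mun').
Qed.
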